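(* Let $n\ge 0$ be an integer. Any $LC^n$-compactum $X$ is an $ALC^n$-space.
   Context: All maps are continuous. A compactum is a compact Hausdorff space (not necessarily metrizable). A space $X$ is $LC^n$ if for every $x\in X$ and every open neighborhood $U$ of $x$ there is a neighborhood $V$ of $x$ such that every map $\mathbb S^k\to V$, $0\le k\le n$, is null-homotopic in $U$. If $M\subset Y$ is closed and $U\subset M$ is open in $M$, an open extension of $U$ in $Y$ is an open set $\widetilde U\subset Y$ with $\widetilde U\cap M=U$. $M$ is $ALC^n$ (approximately locally $n$-connected) in $Y$ if $M\subset Y$ is closed and for every $x\in M$ and every open neighborhood $U$ of $x$ in $M$ there is a neighborhood $V$ of $x$ in $M$ such that for every open extension $\widetilde U$ of $U$ in $Y$ there is an open extension $\widetilde V$ of $V$ in $Y$ such that every map $\mathbb S^k\to\widetilde V$, $0\le k\le n$, is null-homotopic in $\widetilde U$. A compactum is called $ALC^n$ if it is $ALC^n$ in some compact $ANR$ (absolute neighborhood retract in the class of compact Hausdorff spaces) containing it; equivalently, in every compact $ANR$ containing it (e.g. in a Tychonoff cube). *)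

(* Defs.v *)
From HB Require Import structures.
From mathcomp Require Import all_boot all_order all_algebra.
From mathcomp Require Import boolp classical_sets functions set_interval.
From mathcomp Require Import reals topology normedtype.

Set Implicit Arguments.
Unset Strict Implicit.
Unset Printing Implicit Defensive.

Import Order.TTheory GRing.Theory Num.Theory.
Import numFieldNormedType.Exports.

Local Open Scope classical_set_scope.
Local Open Scope ring_scope.

Definition is_compactum (X : topologicalType) : Prop :=
  compact [set: X] /\ hausdorff_space X.

Definition is_embedding (X Y : topologicalType) (e : X -> Y) : Prop :=
  [/\ injective e, continuous e &
      forall A : set X, open A -> open (e @` A : set (subspace (range e)))].

(* A retraction of U onto M is encoded by a total map r : Z -> Z whose values
   outside U are irrelevant; taking Z as codomain also covers M = set0. *)
Definition is_retraction (Z : topologicalType) (U M : set Z) (r : Z -> Z) :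
    Prop :=
  [/\ M `<=` U, {within U, continuous r}, r @` U `<=` M &
      forall z, M z -> r z = z].

Definition compact_ANR (Y : topologicalType) : Prop :=
  is_compactum Y /\
  forall (Z : topologicalType) (e : Y -> Z),
    is_compactum Z -> is_embedding e ->
    exists (U : set Z) (r : Z -> Z), open U /\ is_retraction U (range e) r.

(* The Euclidean unit sphere S^k in R^(k+1); the library norm on row vectors
   is the maximum norm, but it induces the usual topology. *)
Definition sphere (R : realType) (k : nat) : set 'rV[R]_k.+1 :=
  [set v | \sum_(i < k.+1) v ord0 i ^+ 2 = 1].
Arguments sphere : clear implicits.

(* Maps S^k -> A, where A is a subset of X, are total functions of which only
   the restriction to the sphere matters. *)
Definition sphere_map (R : realType) (k : nat) (X : topologicalType)
    (A : set X) (f : 'rV[R]_k.+1 -> X) : Prop :=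
  {within sphere R k, continuous f} /\ f @` sphere R k `<=` A.

Definition null_homotopic_in (R : realType) (k : nat) (X : topologicalType)
    (U : set X) (f : 'rV[R]_k.+1 -> X) : Prop :=
  exists (H : R * 'rV[R]_k.+1 -> X) (c : X),
    [/\ {within `[0, 1]%classic `*` sphere R k, continuous H},
        H @` (`[0, 1]%classic `*` sphere R k) `<=` U,
        forall v, sphere R k v -> H (0, v) = f v &
        forall v, sphere R k v -> H (1, v) = c].

Definition spheres_contract (R : realType) (n : nat) (X : topologicalType)
    (V U : set X) : Prop :=
  forall k : nat, (k <= n)%N ->
  forall f : 'rV[R]_k.+1 -> X, sphere_map V f -> null_homotopic_in U f.

Definition LC (R : realType) (n : nat) (X : topologicalType) : Prop :=
  forall (x : X) (U : set X), open U -> U x ->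
  exists V : set X, nbhs x V /\ spheres_contract R n V U.

Definition open_extension (Y : topologicalType) (M U Ut : set Y) : Prop :=
  open Ut /\ Ut `&` M = U.

(* A subset of M is open in M as a set of the subspace M; the inclusions in M
   are explicit because subspace M has the same carrier as Y. *)
Definition ALC_in (R : realType) (n : nat) (Y : topologicalType) (M : set Y) :
    Prop :=
  closed M /\
  forall (x : Y) (U : set Y), M x ->
    U `<=` M -> open (U : set (subspace M)) -> U x ->
  exists V : set Y,
    [/\ V `<=` M, nbhs (x : subspace M) V &
      forall Ut, open_extension M U Ut ->
      exists Vt, open_extension M V Vt /\ spheres_contract R n Vt Ut].

Definition ALC_compactum (R : realType) (n : nat) (X : topologicalType) :
    Prop :=
  is_compactum X /\
  exists (Y : topologicalType) (e : X -> Y),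
    [/\ compact_ANR Y, is_embedding e & ALC_in R n (range e)].

(* Main.v *)
Require Import Defs.
From mathcomp Require Import all_boot reals topology.
From HB Require Import structures.
From mathcomp Require Import all_order all_algebra.
From mathcomp Require Import mathcomp_extra boolp classical_sets functions.
From mathcomp Require Import prodnormedzmodule normedtype numfun realfun.
From mathcomp Require Import ring lra.

Set Implicit Arguments.
Unset Strict Implicit.
Unset Printing Implicit Defensive.

Import Order.TTheory GRing.Theory Num.Theory.
Import numFieldNormedType.Exports.

Local Open Scope classical_set_scope.
Local Open Scope ring_scope.

(** Embed [X] in the Tychonoff cube [Y] of all its maps to the unit interval; by
Tietze's theorem, applied to each coordinate, [Y] is a compact absolute retract.
Let [f] map a sphere of dimension at most [n] into a small neighbourhood of [X]
in [Y].  If [f] is uniformly close to a map [g] with values in [X], then [f]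
moves to [g] along segments of [Y], which stay near [X], and [g] contracts in
[X] since [X] is locally connected up to dimension [n].  Thus the theorem rests
on [sphere_approximation]: maps close to [X] of spheres of dimension at most [n]
can be approximated by maps into [X].

Such a [g] is usually built over the skeleta of a fine triangulation.  Here the
sphere is a cell with its boundary collapsed to a pole, and a cell is a cube, so
that it can be cut along one coordinate at a time.  The statement proved by
induction, [relative_approximation p m], is about a product of cubes of
dimensions [p] and [m], a map [f] to [Y] depending on the second factor only,
and an approximation prescribed on the boundary of the product.  To treat
[(p, m + 1)], cut the product into thin slabs along the first coordinate of the
second factor: the case [(p, m)] gives approximations on the interfaces, and the
case [(p + 1, m)] extends them over each slab, on which [f] is nearly constant
along that coordinate; this is [approximable_step].

For [m = 0] the map [f] is constant, and the claim is that small maps of the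
boundary of a cell of dimension at most [n + 1] into [X] extend to small maps of
the cell.  This uniform form of local connectedness, [uniform_fill], holds
because the image of [X] is compact and so admits Lebesgue entourages. *)

(** * Continuity on subsets *)

Section Within.
Context {T U V : topologicalType}.
Implicit Types (A : set T) (B : set U).

Lemma withinP A (f : T -> U) : {within A, continuous f} <->
  forall x, A x -> forall W, nbhs (f x) W -> \forall y \near x, A y -> W (f y).
Proof. exact: subspace_continuousP. Qed.

Lemma within_comp A B (f : T -> U) (g : U -> V) :
  {within A, continuous f} -> {within B, continuous g} ->
  (forall x, A x -> B (f x)) -> {within A, continuous (g \o f)}.
Proof.
move=> /subspace_continuousP cf /subspace_continuousP cg AB.
apply/subspace_continuousP => x Ax W Wx.
have := cf x Ax _ (cg _ (AB _ Ax) W Wx).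
rewrite /= !nbhs_simpl /within /=; apply: filterS2 (filterT : nbhs x setT).
by move=> y _ h Ay; apply: h => //; exact: AB.
Qed.

Lemma within_eq A (f g : T -> U) : (forall x, A x -> f x = g x) ->
  {within A, continuous f} -> {within A, continuous g}.
Proof.
move=> fg; apply: subspace_eq_continuous => x; rewrite inE; exact: fg.
Qed.

Lemma within_pair A (f : T -> U) (g : T -> V) :
  {within A, continuous f} -> {within A, continuous g} ->
  {within A, continuous (fun x => (f x, g x))}.
Proof.
move=> /subspace_continuousP cf /subspace_continuousP cg.
by apply/subspace_continuousP => x Ax; apply: cvg_pair; [exact: cf|exact: cg].
Qed.

Lemma continuous_pair (f : T -> U) (g : T -> V) :
  continuous f -> continuous g -> continuous (fun x => (f x, g x)).
Proof. by move=> cf cg x; apply: cvg_pair; [exact: cf|exact: cg]. Qed.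

(** Continuity is a local matter: it may be checked at a point of an open set
[O] on [A `&` O] only.  This is how maps given by a formula off one point are
shown to be continuous. *)
Lemma within_openI A (O : set T) (f : T -> U) x : open O -> O x -> A x ->
  {within A `&` O, continuous f} ->
  forall W, nbhs (f x) W -> \forall y \near x, A y -> W (f y).
Proof.
move=> oO Ox Ax /withinP cf W Wx; have := cf x (conj Ax Ox) W Wx.
apply: filterS2 (open_nbhs_nbhs (conj oO Ox)) => y Oy h Ay; exact: h.
Qed.

End Within.

Lemma fst_continuous (T U : topologicalType) : continuous (@fst T U).
Proof. by move=> x; exact: cvg_fst. Qed.

Lemma snd_continuous (T U : topologicalType) : continuous (@snd T U).
Proof. by move=> x; exact: cvg_snd. Qed.

Lemma closed_setX (T U : topologicalType) (A : set T) (B : set U) :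
  closed A -> closed B -> closed (A `*` B).
Proof.
move=> cA cB; apply: (@closedI _ (fst @^-1` A) (snd @^-1` B)).
  by apply: closed_comp => // x _; exact: fst_continuous.
by apply: closed_comp => // x _; exact: snd_continuous.
Qed.

Section RealFunctions.
Context {R : realType} {T : topologicalType}.
Implicit Types f g : T -> R.

Lemma continuous_subr f g : continuous f -> continuous g ->
  continuous (fun x => f x - g x).
Proof. by move=> cf cg x; apply: (@cvgB _ R^o _ _ _ _ _ _ _ (cf x) (cg x)). Qed.

Lemma continuous_addr f g : continuous f -> continuous g ->
  continuous (fun x => f x + g x).
Proof. by move=> cf cg x; apply: (@cvgD _ R^o _ _ _ _ _ _ _ (cf x) (cg x)). Qed.

Lemma continuous_mulr f g : continuous f -> continuous g ->
  continuous (fun x => f x * g x).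
Proof. by move=> cf cg x; apply: (@cvgM _ _ _ _ _ _ _ _ (cf x) (cg x)). Qed.

Lemma continuous_exprn f i : continuous f -> continuous (fun x => f x ^+ i).
Proof.
move=> cf x; apply: (@continuous_comp _ _ _ f (fun y => y ^+ i));
  first exact: cf.
exact: exprn_continuous.
Qed.

Lemma continuous_scale (A : set T) m (l : T -> R)
    (v : T -> 'rV[R]_m) :
  {within A, continuous l} -> {within A, continuous v} ->
  {within A, continuous (fun x => l x *: v x)}.
Proof.
move=> cl cv x; exact: (@cvgZ _ _ _ _ _ _ _ _ _ (cl x) (cv x)).
Qed.

Lemma within_inv (A : set T) (l : T -> R) :
  (forall x, A x -> l x != 0) ->
  {within A, continuous l} -> {within A, continuous (fun x => (l x)^-1)}.
Proof.
move=> l0 /subspace_continuousP cl; apply/subspace_continuousP => x Ax.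
by apply: cvgV; [exact: l0|exact: cl].
Qed.

End RealFunctions.

Lemma affine_continuous (R : realType) (a b : R) :
  continuous (fun u : R => a * u + b).
Proof.
move=> u; apply: (@cvgD _ R^o); last exact: cvg_cst.
by apply: cvgM; [exact: cvg_cst|exact: cvg_id].
Qed.

(** * Compact sets in uniform spaces *)

Section Entourages.
Local Open Scope relation_scope.

(** The Lebesgue number of an open cover of a compact set.  Being small enough
for a cover is a property of entourages that is stable under shrinking, so it
holds near the filter of small entourages, and local validity spreads over a
compact set. *)
Lemma lebesgue_entourage (T : uniformType) (I : Type) (K : set T)
    (V : I -> set T) :
  compact K -> (forall x, K x -> exists i, nbhs x (V i)) ->
  exists2 D : set (T * T), entourage D &
    forall x, K x -> exists i, forall y, D (x, y) -> V i y.
Proof.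
move=> /compact_near_coveringP cK cov.
have [->|/set0P[x0 _]] := eqVneq K set0.
  by exists setT => //; exact: entourageT.
have entF : ProperFilter (@entourage T).
  by split=> [ent0|]; [exact: (@entourage_refl _ _ x0 ent0)|exact: _].
have near_cov :
  forall x, K x -> \forall x' \near x & D \near powerset_filter_from entourage,
    exists i, forall y, D (x', y) -> V i y.
  move=> x Kx; have [i] := cov x Kx.
  rewrite -nbhs_entourageE => -[E entE EV].
  exists (xsection (split_ent E) x, [set D | D `<=` split_ent E]) => /=.
    split; first exact: nbhs_entourage.
    by apply: small_set_sub; exact: entourage_split_ent.
  move=> [x' D] /= [/xsectionP xx' DE]; exists i => y /DE x'y.
  by apply: EV; apply/xsectionP/(entourage_split x').
have [G [entG _ [D GD]] GP] := cK _ _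
  (fun D x => exists i, forall y, D (x, y) -> V i y)
  (powerset_filter_from_filter entF) near_cov.
exists D; first exact: entG.
by move=> x Kx; exact: (GP D GD x Kx).
Qed.

(** Only one of the two points must lie in [K], so that [F] is controlled on a
neighbourhood of [K] in the sense of entourages. *)
Lemma uniform_continuity_near_compact (T U : uniformType) (K : set T)
    (F : T -> U) :
  compact K -> (forall x, K x -> {for x, continuous F}) ->
  forall E, entourage E -> exists2 D : set (T * T), entourage D &
    forall x y, K x -> D (x, y) -> E (F x, F y).
Proof.
move=> cK cF E entE; pose S := split_ent E.
have entS : entourage (S `&` S^-1).
  apply: entourage_invI; exact: entourage_split_ent.
have [|D entD HD] := @lebesgue_entourage T T K
  (fun x => [set y | (S `&` S^-1) (F x, F y)]) cK.
  move=> x Kx; exists x; have /cvg_entourageP := cF x Kx.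
  exact.
exists D => // x y Kx Dxy; have [z Hz] := HD x Kx.
have [_ zx] := Hz x (entourage_refl x entD); have [zy _] := Hz y Dxy.
exact: (entourage_split (F z)).
Qed.

Lemma prod_entourageE (U V : uniformType) (D : set ((U * V) * (U * V))) :
  entourage D -> exists A B, [/\ entourage A, entourage B &
    forall u u' v v', A (u, u') -> B (v, v') -> D ((u, v), (u', v'))].
Proof.
move=> [[A B] /= [entA entB] ABD]; exists A, B; split=> // u u' v v' Auu Bvv.
have [[[u1 v1] [u2 v2]] /= Duv [<- <- <- <-]] :=
  ABD ((u, u'), (v, v')) (conj Auu Bvv).
exact: Duv.
Qed.

(** A bounded number of scales can be replaced by one; used to serve all the
spheres of dimension at most [n] at the same time. *)
Lemma entourage_bounded (T : uniformType) (n : nat)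
    (P : nat -> set (T * T) -> Prop) :
  (forall k D D', D' `<=` D -> P k D -> P k D') ->
  (forall k, (k <= n)%N -> exists2 D, entourage D & P k D) ->
  exists2 D, entourage D & forall k, (k <= n)%N -> P k D.
Proof.
move=> PS; elim: n => [|n IHn] HP.
  by have [D entD PD] := HP 0%N (leqnn _); exists D => // k;
    rewrite leqn0 => /eqP ->.
have [|D entD PD] := IHn; first by move=> k kn; apply: HP; exact: leqW.
have [D' entD' PD'] := HP n.+1 (leqnn _).
exists (D `&` D'); first exact: filterI.
move=> k; rewrite leq_eqVlt => /orP[/eqP ->|kn].
  by apply: PS PD' => ? [].
by apply: PS (PD k kn) => ? [].
Qed.

End Entourages.

(** * Row vectors in the maximum norm *)

Section RowVectors.
Context {R : realType}.
Implicit Types (m : nat).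

Definition rv_cons m (s : R) (b : 'rV[R]_m) : 'rV[R]_m.+1 :=
  \row_j (if unlift ord0 j is Some i then b ord0 i else s).

Definition rv_tail m (c : 'rV[R]_m.+1) : 'rV[R]_m :=
  \row_j c ord0 (lift ord0 j).

Lemma rv_cons_head m s (b : 'rV[R]_m) : rv_cons s b ord0 ord0 = s.
Proof. by rewrite mxE unlift_none. Qed.

Lemma rv_consS m s (b : 'rV[R]_m) i : rv_cons s b ord0 (lift ord0 i) = b ord0 i.
Proof. by rewrite mxE liftK. Qed.

Lemma rv_consK m s (b : 'rV[R]_m) : rv_tail (rv_cons s b) = b.
Proof. by apply/rowP => i; rewrite mxE rv_consS. Qed.

Lemma rv_tailK m (c : 'rV[R]_m.+1) : rv_cons (c ord0 ord0) (rv_tail c) = c.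
Proof.
by apply/rowP => j; rewrite mxE; case: unliftP => [i|] ->; rewrite ?mxE.
Qed.

Lemma rv_norm_le m (v : 'rV[R]_m) (r : R) :
  `|v| <= r <-> 0 <= r /\ forall i, `|v ord0 i| <= r.
Proof.
rewrite [`|v|]mx_normrE; split=> [/bigmax_leP[r0 H]|[r0 H]].
  by split=> // i; exact: (H (ord0, i)).
by apply/bigmax_leP; split=> // -[i j] _ /=; rewrite (ord1 i).
Qed.

Lemma rv_coord_le m (v : 'rV[R]_m) i : `|v ord0 i| <= `|v|.
Proof. by have [_ ->] := (rv_norm_le v `|v|).1 (lexx _). Qed.

Lemma rv_norm_cons m s (b : 'rV[R]_m) : `|rv_cons s b| = Num.max `|s| `|b|.
Proof.
apply/eqP; rewrite eq_le ge_max; apply/and3P; split.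
- apply/rv_norm_le; split=> [|i]; first by rewrite le_max normr_ge0.
  rewrite mxE; case: unliftP => [j|] _; last by rewrite le_max lexx.
  by rewrite le_max rv_coord_le orbT.
- by have := rv_coord_le (rv_cons s b) ord0; rewrite rv_cons_head.
- apply/rv_norm_le; split=> // i; rewrite -(rv_consS s); exact: rv_coord_le.
Qed.

Lemma rv_norm_const1 k : `|const_mx 1 : 'rV[R]_k.+1| = 1.
Proof.
apply/eqP; rewrite eq_le; apply/andP; split.
  by apply/rv_norm_le; split=> // i; rewrite mxE normr1.
by have := rv_coord_le (const_mx 1 : 'rV[R]_k.+1) ord0; rewrite mxE normr1.
Qed.

Lemma within_row {T : topologicalType} (A : set T) m (f : T -> 'rV[R]_m) :
  (forall i, {within A, continuous (fun x => f x ord0 i)}) ->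
  {within A, continuous f}.
Proof.
move=> cf; apply/subspace_continuousP => x Ax W [P Pf PW].
have near_coord : \forall y \near within A (nbhs x),
    forall ij : 'I_1 * 'I_m, P ij.1 ij.2 (f y ij.1 ij.2).
  apply: filter_forall => -[i j] /=; rewrite (ord1 i).
  have /subspace_continuousP/(_ x Ax) := cf j; apply; exact: Pf.
rewrite /= nbhs_simpl; apply: filterS near_coord => y H.
by apply: PW => i j; exact: (H (i, j)).
Qed.

Lemma continuous_row {T : topologicalType} m (f : T -> 'rV[R]_m) :
  (forall i, continuous (fun x => f x ord0 i)) -> continuous f.
Proof.
move=> cf; apply/continuous_subspace_setT; apply: within_row => i.
exact: continuous_subspaceT.
Qed.

Lemma rv_tail_continuous m : continuous (@rv_tail m).
Proof.
apply: continuous_row => i;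
  rewrite (_ : (fun _ => _) = fun c : 'rV[R]_m.+1 => c ord0 (lift ord0 i)).
  exact: coord_continuous.
by apply/funext => c; rewrite mxE.
Qed.

Lemma rv_cons_continuous m :
  continuous (fun c : R * 'rV[R]_m => rv_cons c.1 c.2).
Proof.
apply: continuous_row => i; case: (unliftP ord0 i) => [j|] ->.
  rewrite (_ : (fun _ => _) = fun c : R * 'rV[R]_m => c.2 ord0 j).
    move=> c.
    apply: (@continuous_comp _ _ _ snd (fun b : 'rV[R]_m => b ord0 j)).
      exact: cvg_snd.
    exact: coord_continuous.
  by apply/funext => c; rewrite rv_consS.
rewrite (_ : (fun _ => _) = fst); first by move=> c; exact: cvg_fst.
by apply/funext => c; rewrite rv_cons_head.
Qed.

Lemma continuous_rv_cons (T : topologicalType) m (l : T -> R)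
    (v : T -> 'rV[R]_m) :
  continuous l -> continuous v -> continuous (fun x => rv_cons (l x) (v x)).
Proof.
move=> cl cv x; apply: (@continuous_comp _ _ _ (fun x => (l x, v x))
  (fun c => rv_cons c.1 c.2)); last exact: rv_cons_continuous.
exact: continuous_pair.
Qed.

Lemma rv_ball_compact m : compact [set v : 'rV[R]_m | `|v| <= 1].
Proof.
apply: bounded_closed_compact.
  by exists 1; split; [exact: real1|move=> M M1 v /= v1;
    exact: (le_trans v1 (ltW M1))].
apply: (@closed_comp _ _ (fun v : 'rV[R]_m => `|v|) [set x : R | x <= 1]).
  by move=> v _; exact: norm_continuous.
exact: closed_le.
Qed.

End RowVectors.

(** * The Tychonoff cube of a compactum *)

Section TychonoffCube.
Context {R : realType}.

Definition unit_itv : Type := set_type (`[0, 1]%classic : set R).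
HB.instance Definition _ := Uniform.on unit_itv.

Definition clamp (x : R) : R := Num.min 1 (Num.max 0 x).

Lemma clamp_in x : clamp x \in (`[0, 1]%classic : set R).
Proof.
by rewrite inE /= in_itv /= /clamp ge_min lexx le_min ler01 le_max lexx.
Qed.

Lemma clamp_id x : 0 <= x <= 1 -> clamp x = x.
Proof. by move=> /andP[x0 x1]; rewrite /clamp max_r // min_r. Qed.

Lemma clamp_continuous : continuous clamp.
Proof.
move=> x; apply: (@continuous_min R R (fun=> 1) (fun x => Num.max 0 x)).
  exact: cvg_cst.
by apply: (@continuous_max R R (fun=> 0) id); [exact: cvg_cst|exact: cvg_id].
Qed.

Definition to_itv (x : R) : unit_itv := SigSub (clamp_in x).

Definition of_itv (u : unit_itv) : R := set_val u.

Lemma to_itvK x : of_itv (to_itv x) = clamp x.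
Proof. by []. Qed.

Lemma of_itv_in u : 0 <= of_itv u <= 1.
Proof. by have := set_valP u; rewrite /= in_itv. Qed.

Lemma of_itvK u : to_itv (of_itv u) = u.
Proof. by apply: val_inj; rewrite /= clamp_id //; exact: of_itv_in. Qed.

Lemma of_itv_continuous : continuous of_itv.
Proof. exact: initial_continuous. Qed.

Lemma to_itv_continuous : continuous to_itv.
Proof.
apply: (@continuous_comp_initial unit_itv R R set_val to_itv).
exact: clamp_continuous.
Qed.

Lemma unit_itv_compact : compact [set: unit_itv].
Proof.
rewrite (_ : setT = to_itv @` `[0, 1]%classic).
  apply: continuous_compact; last exact: segment_compact.
  exact/continuous_subspaceT/to_itv_continuous.
apply/seteqP; split=> // u _; exists (of_itv u); last exact: of_itvK.
by rewrite /= in_itv; exact: of_itv_in.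
Qed.

Lemma unit_itv_hausdorff : hausdorff_space unit_itv.
Proof.
move=> u v uv; apply: val_inj; apply: Rhausdorff => A B Au Bv.
have [w [Aw Bw]] := uv _ _ (of_itv_continuous Au) (of_itv_continuous Bv).
by exists (of_itv w).
Qed.

Definition tychonoff_cube (I : Type) := prod_topology (fun _ : I => unit_itv).
HB.instance Definition _ (I : Type) := Uniform.on (tychonoff_cube I).

(** The point of [X] only serves as the value of the inverse off the image. *)
Lemma embedding_inverse (X Y : topologicalType) (e : X -> Y) : X ->
  is_embedding e ->
  exists2 inv : Y -> X, cancel e inv & {within range e, continuous inv}.
Proof.
move=> x0 [injE _ openE]; have [inv invK] : exists inv, cancel e inv.
  exists (fun y => xget x0 [set x | e x = y]) => x; apply: injE;
    exact: (@xgetPex _ x0 [set x' | e x' = e x] (ex_intro _ x erefl)).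
exists inv => //; apply/continuousP => A oA; rewrite -open_subspaceIT.
rewrite (_ : _ `&` _ = e @` A); first exact: openE.
apply/seteqP; split=> [y [Ay [x _ xy]]|_ [x Ax <-]].
  by exists x => //; move: Ay; rewrite -xy /= /from_subspace invK.
by split; [rewrite /= /from_subspace invK|exists x].
Qed.

Lemma compact_embedding (X Y : topologicalType) (e : X -> Y) :
  compact [set: X] -> hausdorff_space Y -> injective e -> continuous e ->
  is_embedding e.
Proof.
move=> cX hY injE contE; split=> // A oA.
apply/open_subspaceP; exists (~` (e @` (~` A))).
  rewrite openC; apply: compact_closed => //; apply: continuous_compact.
    exact: continuous_subspaceT.
  by apply: subclosed_compact cX _ => //; exact: open_closedC.
apply/seteqP; split=> [y [Hy [x _ xy]]|y [[x Ax xy] _]]; split; rewrite -?xy //.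
- by exists x => //; apply: contrapT => nAx; apply: Hy; exists x.
- by move=> [x' nAx' /injE x'x]; apply: nAx'; rewrite x'x.
Qed.

(** The classical wrapper provides the decidable equality that the theory of
product spaces asks of an index type. *)
Definition unit_functions (X : topologicalType) :=
  {classic {f : X -> R | continuous f /\ forall x, 0 <= f x <= 1}}.

Definition evaluation (X : topologicalType) (x : X) :
    tychonoff_cube (unit_functions X) := fun f => to_itv (sval f x).

Section CubeTheory.
Variable I : choiceType.
Local Notation cube := (tychonoff_cube I).

Definition coord (i : I) (y : cube) : R := of_itv (y i).

Lemma coord_cube_continuous i : continuous (coord i).
Proof.
have -> : coord i = of_itv \o @proj I (fun=> unit_itv) i by [].
move=> y; apply: continuous_comp.
  exact: (@proj_continuous I (fun=> unit_itv) i).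
exact: of_itv_continuous.
Qed.

Lemma cube_continuous (T : topologicalType) (f : T -> cube) :
  (forall i, continuous (fun x => coord i (f x))) -> continuous f.
Proof.
move=> cf x; apply/cvg_sup => i.
apply: (@continuous_comp_initial _ _ _ (fun y : forall _, unit_itv => y i) f).
rewrite (_ : _ \o _ = to_itv \o (fun x => coord i (f x))).
  move=> z; apply: continuous_comp; first exact: cf.
  exact: to_itv_continuous.
by apply/funext => z /=; rewrite of_itvK.
Qed.

Lemma cube_compactum : is_compactum cube.
Proof.
split.
  have := @tychonoff I (fun=> unit_itv) (fun=> setT) (fun=> unit_itv_compact).
  by congr compact; apply/seteqP.
apply: (@hausdorff_product I (fun=> unit_itv)) => _; exact: unit_itv_hausdorff.
Qed.

(** A Tychonoff cube is an absolute retract: the coordinates of the inverse of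
an embedding into a compactum [Z] are real functions on a closed subset of the
normal space [Z], and Tietze's theorem extends each of them to [Z].  Hence the
neighbourhood that is retracted can be all of [Z]. *)
Lemma cube_compact_ANR : compact_ANR cube.
Proof.
split=> [|Z e [cZ hZ] emb_e]; first exact: cube_compactum.
have [injE contE _] := emb_e.
have [inv invK contI] := embedding_inverse ((fun=> to_itv 0) : cube) emb_e.
have clM : closed (range e).
  apply: compact_closed => //; apply: continuous_compact.
    exact: continuous_subspaceT.
  by have [] := cube_compactum.
have ext i : exists g : Z -> R, continuous g /\
    forall y, g (e y) = coord i y.
  have [||g [gE gC _]] := @continuous_bounded_extension Z R
    (compact_normal hZ cZ) (range e) clM (coord i \o inv) 1 ltr01.
  - apply: (within_comp (B := setT) contI) => //.
    exact/continuous_subspaceT/coord_cube_continuous.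
  - move=> z _ /=; have /andP[c0 c1] := of_itv_in (inv z i).
    by rewrite ger0_norm.
  exists g; split=> // y; rewrite -gE /= ?invK //; apply/mem_set; by exists y.
have [g gP] := choice ext.
pose r z : Z := e (fun i => to_itv (g i z)).
exists setT, r; split; first exact: openT.
have re y : r (e y) = e y.
  congr e; apply/funext => i; have [_ ->] := gP i; exact: of_itvK.
split=> //.
- apply: continuous_subspaceT => z; apply: continuous_comp (contE _).
  apply: cube_continuous => i; move=> w.
  apply: (@continuous_comp _ _ _ (g i) clamp); first by have [+ _] := gP i;
    exact.
  exact: clamp_continuous.
- by move=> _ [z _ <-]; exists (fun i => to_itv (g i z)).
- by move=> _ [y _ <-].
Qed.

(** The segment from [a] to [b]; the cube is convex, so [to_itv] does not
truncate anything when [t] is in the unit interval. *)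
Definition mix (t : R) (a b : cube) : cube :=
  fun i => to_itv ((1 - t) * coord i a + t * coord i b).

Lemma mix_continuous :
  continuous (fun c : R * (cube * cube) => mix c.1 c.2.1 c.2.2).
Proof.
apply: cube_continuous => i c.
apply: (@continuous_comp _ _ _ (fun c : R * (cube * cube) =>
  (1 - c.1) * coord i c.2.1 + c.1 * coord i c.2.2) clamp); last first.
  exact: clamp_continuous.
have cfst : {for c, continuous (fst : R * (cube * cube) -> R)}.
  exact: cvg_fst.
have csnd : {for c, continuous (snd : R * (cube * cube) -> _)}.
  exact: cvg_snd.
apply: (@continuousD R R^o).
  apply: continuousM.
    by apply: (@continuousB R R^o) => //; exact: cvg_cst.
  apply: (@continuous_comp _ _ _
    (fun c : R * (cube * cube) => c.2.1) (coord i)).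
    by apply: continuous_comp; [exact: csnd|exact: cvg_fst].
  exact: coord_cube_continuous.
apply: continuousM => //.
apply: (@continuous_comp _ _ _ (fun c : R * (cube * cube) => c.2.2) (coord i)).
  by apply: continuous_comp; [exact: csnd|exact: cvg_snd].
exact: coord_cube_continuous.
Qed.

Lemma mix0 a b : mix 0 a b = a.
Proof.
by apply/funext => i; rewrite /mix subr0 mul1r mul0r addr0 of_itvK.
Qed.

Lemma mix1 a b : mix 1 a b = b.
Proof.
by apply/funext => i; rewrite /mix subrr mul1r mul0r add0r of_itvK.
Qed.

Lemma mixxx t a : mix t a a = a.
Proof.
by apply/funext => i; rewrite /mix -mulrDl subrK mul1r of_itvK.
Qed.

(** Segments between close points are short: [mix] is uniformly continuous
near the compact set of triples [(t, (a, a))], on which it takes the value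
[a]. *)
Lemma mix_close E : entourage E -> exists2 D : set (cube * cube), entourage D &
  forall a b t, 0 <= t <= 1 -> D (a, b) -> E (a, mix t a b).
Proof.
move=> entE; pose K := (fun c : R * cube => (c.1, (c.2, c.2))) @`
  (`[0, 1]%classic `*` setT).
have cK : compact K.
  apply: continuous_compact.
    apply/continuous_subspaceT/continuous_pair; first exact: fst_continuous.
    by apply: continuous_pair; exact: snd_continuous.
  by apply: compact_setX; [exact: segment_compact|have [] := cube_compactum].
have [D entD HD] :=
  uniform_continuity_near_compact cK (fun c _ => @mix_continuous c) entE.
have [A [B [entA entB ABD]]] := prod_entourageE entD.
have [C [C' [entC entC' CB]]] := prod_entourageE entB.
exists C' => // a b t t01 Cab; rewrite -{1}[a](mixxx t).
apply: (HD (t, (a, a)) (t, (a, b))).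
  by exists (t, a) => //; split=> //; rewrite /= in_itv.
by apply: ABD; [exact: entourage_refl|apply: CB => //; exact: entourage_refl].
Qed.

End CubeTheory.

(** Urysohn functions separate the points of a compactum. *)
Lemma evaluation_embedding (X : topologicalType) :
  is_compactum X -> is_embedding (@evaluation X).
Proof.
move=> [cX hX]; have [_ hC] := cube_compactum (unit_functions X).
apply: compact_embedding => //; last first.
  apply: cube_continuous => f x.
  apply: (@continuous_comp _ _ _ (sval f) clamp); last exact: clamp_continuous.
  by case: f => f [cf ?]; exact: cf.
move=> x y exy; apply: contrapT => nxy.
have cl1 (z : X) : closed [set z].
  by apply: accessible_closed_set1; exact: hausdorff_accessible.
have xy0 : [set x] `&` [set y] = set0.
  by apply/seteqP; split=> // z [/= -> yz]; exact: nxy.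
have [g [cg gx gy g01]] := urysohn_ext_itv (R := R) (compact_normal hX cX)
  (cl1 x) (cl1 y) xy0 ltr01.
have g01' z : 0 <= g z <= 1.
  by have := g01 (g z) (ex_intro2 _ _ z I erefl); rewrite /= in_itv.
have := congr1 (fun h => of_itv (h (exist _ g (conj cg g01')))) exy.
rewrite !to_itvK /= !clamp_id ?g01' //.
have -> : g x = 0 by apply: gx; exists x.
have -> : g y = 1 by apply: gy; exists y.
by move/eqP; rewrite eq_sym oner_eq0.
Qed.

End TychonoffCube.

(** * From spheres to cells *)

Section SquareNorm.
Context {R : realType}.

Definition sqnorm m (v : 'rV[R]_m) : R := \sum_(i < m) v ord0 i ^+ 2.

Lemma sqnorm_ge0 m (v : 'rV[R]_m) : 0 <= sqnorm v.
Proof. by apply: sumr_ge0 => i _; exact: sqr_ge0. Qed.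

Lemma sqnorm_gt0 m (v : 'rV[R]_m) : v != 0 -> 0 < sqnorm v.
Proof.
move=> v0; rewrite lt_neqAle sqnorm_ge0 andbT eq_sym; apply: contra v0.
rewrite psumr_eq0 => [/allP v0|i _]; last exact: sqr_ge0.
apply/eqP/rowP => i; apply/eqP; rewrite mxE.
by have := v0 i (mem_index_enum i); rewrite /= expf_eq0.
Qed.

Lemma sqnormZ m t (v : 'rV[R]_m) : sqnorm (t *: v) = t ^+ 2 * sqnorm v.
Proof.
by rewrite /sqnorm mulr_sumr; apply: eq_bigr => i _; rewrite mxE exprMn.
Qed.

Lemma sqnorm_cons m s (b : 'rV[R]_m) : sqnorm (rv_cons s b) = s ^+ 2 + sqnorm b.
Proof.
rewrite /sqnorm big_ord_recl rv_cons_head; congr (_ + _).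
by apply: eq_bigr => i _; rewrite rv_consS.
Qed.

Lemma sqnorm_le m (v : 'rV[R]_m) : sqnorm v <= m%:R * `|v| ^+ 2.
Proof.
have -> : m%:R * `|v| ^+ 2 = \sum_(i < m) `|v| ^+ 2.
  by rewrite sumr_const card_ord mulr_natl.
apply: ler_sum => i _.
by rewrite -real_normK ?num_real // lerXn2r ?nnegrE // rv_coord_le.
Qed.

Lemma norm_le_sqnorm m (v : 'rV[R]_m) : sqnorm v = 1 -> `|v| <= 1.
Proof.
move=> v1; apply/rv_norm_le; split=> // i.
rewrite -(@expr_le1 _ 2) // real_normK ?num_real // -v1 /sqnorm (bigD1 i) //=.
by rewrite lerDl; apply: sumr_ge0 => j _; exact: sqr_ge0.
Qed.

Lemma sqnorm_continuous m : continuous (@sqnorm m).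
Proof.
apply: continuous_big => [|i _ v]; first exact: add_continuous.
apply: (@continuous_comp _ _ _
  (fun v : 'rV[R]_m => v ord0 i) (fun x => x ^+ 2)).
  exact: coord_continuous.
exact: exprn_continuous.
Qed.

Lemma sphere_closed k : closed (sphere R k).
Proof.
apply: (@closed_comp _ _ (@sqnorm k.+1) [set 1]); last exact: closed_eq.
by move=> v _; exact: sqnorm_continuous.
Qed.

Lemma sphere_compact k : compact (sphere R k).
Proof.
apply: (subclosed_compact (@sphere_closed k) (@rv_ball_compact R k.+1)) => v.
exact: norm_le_sqnorm.
Qed.

Lemma normalize_sphere k (v : 'rV[R]_k.+1) : v != 0 ->
  sphere R k ((Num.sqrt (sqnorm v))^-1 *: v).
Proof.
move=> v0; rewrite /sphere /= -/(sqnorm _) sqnormZ exprVn.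
rewrite sqr_sqrtr ?sqnorm_ge0 //.
by rewrite mulVf // gt_eqF // sqnorm_gt0.
Qed.

Lemma sphere_neq0 k (v : 'rV[R]_k.+1) : sphere R k v -> v != 0.
Proof.
move=> v1; apply/eqP => v0; move: v1; rewrite /sphere /= v0 big1 => [/eqP|i _].
  by rewrite eq_sym oner_eq0.
by rewrite mxE expr0n.
Qed.

(** Radial projection identifies the Euclidean sphere with the boundary of the
cell [`|a| <= 1] of the maximum norm.  A null-homotopy of the transported map
fills the cell: the sphere of radius [r] carries the stage [1 - r] of the
homotopy, and the centre is sent to the constant value of the last stage. *)
Lemma cell_extension (X : topologicalType) (V U : set X) n k
    (h : 'rV[R]_k.+1 -> X) :
  spheres_contract R n V U -> (k <= n)%N ->
  {within [set a | `|a| = 1], continuous h} ->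
  (forall a, `|a| = 1 -> V (h a)) ->
  exists H : 'rV[R]_k.+1 -> X,
    [/\ {within [set a | `|a| <= 1], continuous H},
        forall a, `|a| = 1 -> H a = h a &
        forall a, `|a| <= 1 -> U (H a)].
Proof.
move=> VU kn ch hV.
pose psi (v : 'rV[R]_k.+1) := `|v|^-1 *: v.
have psi1 v : sphere R k v -> `|psi v| = 1.
  by move=> /sphere_neq0 v0; rewrite normrZ normfV normr_id mulVf // normr_eq0.
have cnorm (A : set 'rV[R]_k.+1) : {within A, continuous (fun v => `|v|)}.
  by apply: continuous_subspaceT => v; exact: norm_continuous.
have cpsi : {within sphere R k, continuous psi}.
  apply: continuous_scale; last by apply: continuous_subspaceT => v;
    exact: cvg_id.
  apply: within_inv => // v /sphere_neq0; by rewrite normr_eq0.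
have [|Hom [c [cHom HomU Hom0 Hom1]]] := VU k kn (h \o psi).
  split; first by apply: within_comp cpsi ch _ => v /psi1.
  by move=> _ [v vS <-]; apply: hV; exact: psi1.
pose phi (a : 'rV[R]_k.+1) := (Num.sqrt (sqnorm a))^-1 *: a.
pose H a := if a == 0 then c else Hom (1 - `|a|, phi a).
exists H; split.
- apply/withinP => a a1; have [a0|a0] := eqVneq a 0; last first.
    apply: (within_openI (O := [set a | a != 0])) => //.
      rewrite (_ : [set _ | _] = ~` [set 0]); last first.
        by apply/seteqP; split=> x /eqP.
      by rewrite openC; apply: accessible_closed_set1;
        apply: hausdorff_accessible; exact: norm_hausdorff.
    apply: (@within_eq _ _ _ (Hom \o (fun a => (1 - `|a|, phi a)))).
      by move=> x [_ /= x0]; rewrite /from_subspace /H (negbTE x0).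
    apply: within_comp cHom _.
      apply: within_pair.
        move=> x; apply: (@cvgB _ R^o); [exact: cvg_cst|exact: cnorm].
      apply: continuous_scale; last by apply: continuous_subspaceT => v;
        exact: cvg_id.
      apply: within_inv.
        by move=> x [_ /= x0]; rewrite sqrtr_eq0 -ltNge sqnorm_gt0.
      apply: continuous_subspaceT => x.
      by apply: continuous_comp;
        [exact: sqnorm_continuous|exact: sqrt_continuous].
    move=> x [/= x1 x0]; split=> /=; last exact: normalize_sphere.
    by rewrite in_itv /=; have := normr_ge0 x; lra.
  rewrite a0 => W; rewrite {1}/H eqxx => Wc.
  (* At the centre the direction of [a] is undefined; compactness of the sphere
     makes the last stages of the homotopy close to [c] in all directions at
     once. *)
  have /compact_near_coveringP/near_covering_withinP cS := @sphere_compact k.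
  have near_cov : forall v, sphere R k v ->
    \forall v' \near v & a' \near nbhs (0 : 'rV[R]_k.+1),
      sphere R k v' -> `|a'| <= 1 -> W (Hom (1 - `|a'|, v')).
    move=> v Sv; have /withinP := cHom.
    have I1S : (`[0, 1]%classic `*` sphere R k) (1 : R, v).
      by split=> //=; rewrite in_itv /= ler01 lexx.
    move=> /(_ _ I1S W); rewrite (Hom1 v Sv) => /(_ Wc) nW.
    have cpull : continuous
        (fun c : 'rV[R]_k.+1 * 'rV[R]_k.+1 => (1 - `|c.2|, c.1)).
      apply: continuous_pair; last exact: fst_continuous.
      move=> x; apply: (@cvgB _ R^o); first exact: cvg_cst.
      by apply: cvg_norm; exact: snd_continuous.
    have : nbhs (1 - `|(0 : 'rV[R]_k.+1)|, v)
        [set y | (`[0, 1]%classic `*` sphere R k) y -> W (Hom y)].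
      by rewrite normr0 subr0.
    move=> /(cpull (v, 0)) npull.
    apply: (@filterS _ (nbhs (v, 0 : 'rV[R]_k.+1)) _ _ _ _ npull).
    move=> -[v' a'] /= HomW Sv' a'1.
    apply: HomW; split=> //=; rewrite in_itv /=.
    by have := normr_ge0 a'; lra.
  have := cS _ _ (fun a' v' => `|a'| <= 1 -> W (Hom (1 - `|a'|, v')))
    (nbhs_filter (0 : 'rV[R]_k.+1)) near_cov.
  apply: filterS => a' HomW a'1; rewrite /H; case: eqVneq => [_|a'0].
    exact: nbhs_singleton.
  by apply: HomW => //; exact: normalize_sphere.
- move=> a a1; have a0 : a != 0 by rewrite -normr_eq0 a1 oner_neq0.
  rewrite /H (negbTE a0) a1 subrr Hom0 /=; last exact: normalize_sphere.
  congr h; rewrite /psi /phi scalerA normrZ a1 mulr1.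
  have s0 : 0 < Num.sqrt (sqnorm a) by rewrite sqrtr_gt0 sqnorm_gt0.
  by rewrite gtr0_norm ?invr_gt0 // invrK mulfV ?scale1r // gt_eqF.
- move=> a a1; rewrite /H; case: eqVneq => [_|a0]; apply: HomU.
    have v1 := @normalize_sphere k (const_mx 1).
    set v := _ *: _ in v1; exists (1, v); last first.
      by apply: Hom1; apply: v1; apply/eqP => /rowP/(_ ord0)/eqP;
        rewrite !mxE oner_eq0.
    split; first by rewrite /= in_itv /= ler01 lexx.
    by apply: v1; apply/eqP => /rowP/(_ ord0)/eqP; rewrite !mxE oner_eq0.
  exists (1 - `|a|, phi a) => //; split; last exact: normalize_sphere.
  by rewrite /= in_itv /=; have := normr_ge0 a; lra.
Qed.

End SquareNorm.

(** * Uniform local connectedness of compacta *)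

Section UniformLC.
Local Open Scope relation_scope.
Context {R : realType} {X : topologicalType} {Y : uniformType}.
Variable e : X -> Y.

(** Local connectedness at a uniform scale.  The size of maps into [X] is
measured around a point [y] of the ambient space, since the maps to be filled
will approximate maps with values there. *)
Definition fills_cells k (D E : set (Y * Y)) :=
  forall (y : Y) (h : 'rV[R]_k.+1 -> X),
  {within [set a | `|a| = 1], continuous h} ->
  (forall a, `|a| = 1 -> D (y, e (h a))) ->
  exists H : 'rV[R]_k.+1 -> X,
    [/\ {within [set a | `|a| <= 1], continuous H},
        forall a, `|a| = 1 -> H a = h a &
        forall a, `|a| <= 1 -> E (y, e (H a))].

Hypothesis emb_e : is_embedding e.
Hypothesis compact_range : compact (range e).

Lemma embedding_nbhs x (V : set X) : nbhs x V ->
  nbhs (e x) [set y | forall x', e x' = y -> V x'].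
Proof.
have [injE _ openE] := emb_e.
rewrite nbhsE => -[O [oO Ox] OV].
have /open_subspaceP [W oW WO] := openE O oO.
have Wx : W (e x).
  have : (W `&` range e) (e x) by rewrite WO; split; [exists x|exists x].
  by case.
apply: filterS (open_nbhs_nbhs (conj oW Wx)) => y Wy x' x'y; apply: OV.
have : (W `&` range e) y by split=> //; exists x'.
by rewrite WO -x'y => -[[z Oz /injE <-]].
Qed.

(** The neighbourhoods given by local connectedness at the points of [X] form a
cover of the compact image of [X]; maps that are small with respect to its
Lebesgue entourage have their image in one of them. *)
Lemma uniform_fill n : LC R n X ->
  forall E, entourage E -> exists2 D : set (Y * Y), entourage D &
    forall k, (k <= n)%N -> fills_cells k D E.
Proof.
move=> hLC E entE; have [_ contE _] := emb_e.
pose S := split_ent E; have entS : entourage S by exact: entourage_split_ent.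
pose S' := split_ent S; have entS' : entourage S' by exact: entourage_split_ent.
pose E1 := S' `&` S'^-1; have entE1 : entourage E1 by exact: entourage_invI.
pose U x := interior [set x' | E1 (e x, e x')].
have /choice [V HV] : forall x,
    exists V, nbhs x V /\ spheres_contract R n V (U x).
  move=> x; apply: hLC; first exact: open_interior.
  have /cvg_entourageP/(_ _ entE1) := contE x; exact.
have [|D1 entD1 HD1] := lebesgue_entourage
    (V := fun x => [set y | forall x', e x' = y -> V x x']) compact_range.
  by move=> _ [x _ <-]; exists x; apply: embedding_nbhs; have [] := HV x.
pose D2 := split_ent D1;
  have entD2 : entourage D2 by exact: entourage_split_ent.
exists (S `&` (D2 `&` D2^-1)); first by apply: filterI => //;
  exact: entourage_invI.
move=> k kn y h ch hy; pose a0 := const_mx 1 : 'rV[R]_k.+1.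
have a01 : `|a0| = 1 by exact: rv_norm_const1.
have [Sy0 [_ D20]] := hy a0 a01.
have [x1 Hx1] := HD1 _ (ex_intro2 _ _ (h a0) I erefl).
have [_ VU] := HV x1.
have [|H [cH Hh HU]] := cell_extension VU kn ch.
  move=> a a1; apply: (Hx1 (e (h a))) => //.
  by have [_ [D2a _]] := hy a a1; exact: (entourage_split y).
(* From [y] to the image of [a0], then to the centre [x1] of the
   neighbourhood, then to the image of [a]. *)
exists H; split=> // a a1.
have a0le : `|a0| <= 1 by rewrite a01.
have /interior_subset [_ S'1] := HU a0 a0le.
have /interior_subset [S'2 _] := HU a a1.
apply: (entourage_split (e (h a0))) => //.
by apply: (entourage_split (e x1)) => //; rewrite -(Hh a0 a01).
Qed.

End UniformLC.

(** * Approximation on cubes relative to the boundary *)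

Section RelativeApproximation.
Local Open Scope relation_scope.
Context {R : realType} {X : topologicalType} {Y : uniformType}.
Variable e : X -> Y.

(** In the product of the cells of dimensions [p] and [m] the map [f] to be
approximated depends on the second factor only.  The first factor collects the
directions in which a given map varies so little that it may be taken to be
constant.  In the norm of a product, which is a maximum, [`|c| = 1] is the
boundary of the product of the two cells. *)
Definition relative_approximation p m (D E : set (Y * Y)) :=
  forall (f : 'rV[R]_m -> Y) (g0 : 'rV[R]_p * 'rV[R]_m -> X),
  continuous f ->
  (forall b, `|b| <= 1 -> exists x, D (f b, e x)) ->
  {within [set c | `|c| = 1], continuous g0} ->
  (forall c, `|c| = 1 -> D (f c.2, e (g0 c))) ->
  exists g : 'rV[R]_p * 'rV[R]_m -> X,
    [/\ {within [set c | `|c| <= 1], continuous g},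
        forall c, `|c| = 1 -> g c = g0 c &
        forall c, `|c| <= 1 -> E (f c.2, e (g c))].

Lemma max_eq1 (x y : R) :
  Num.max x y = 1 -> [/\ x <= 1, y <= 1 & x = 1 \/ y = 1].
Proof.
case: (leP x y) => [xy y1|/ltW yx x1].
  by split; [rewrite -y1|rewrite y1|right].
by split; [rewrite x1|rewrite -x1|left].
Qed.

Lemma norm_consl p m s (a : 'rV[R]_p) (b : 'rV[R]_m) :
  `|(rv_cons s a, b)| = Num.max `|s| `|(a, b)|.
Proof. by rewrite !prod_normE /= rv_norm_cons maxA. Qed.

Lemma norm_consr p m s (a : 'rV[R]_p) (b : 'rV[R]_m) :
  `|(a, rv_cons s b)| = Num.max `|s| `|(a, b)|.
Proof. by rewrite !prod_normE /= rv_norm_cons maxCA. Qed.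

(** On a thin slab [s <= t <= s'] of the first coordinate of the second factor,
[f] is replaced by its restriction to the face [s], and that coordinate joins
the first factor, rescaled by [tau] to the interval from -1 to 1.  The boundary
values are [h] and [h'] on the two faces of the slab and [g0] on the rest. *)
Lemma slab_fill p m (D E : set (Y * Y)) (f : 'rV[R]_m.+1 -> Y)
    (g0 : 'rV[R]_p * 'rV[R]_m.+1 -> X) (s s' : R)
    (h h' : 'rV[R]_p * 'rV[R]_m -> X) :
  relative_approximation p.+1 m D E -> -1 <= s -> s < s' -> s' <= 1 ->
    continuous f ->
  {within [set c | `|c| <= 1], continuous h} ->
  {within [set c | `|c| <= 1], continuous h'} ->
  {within [set c | `|c| = 1], continuous g0} ->
  (forall b, `|b| <= 1 -> exists x, D (f (rv_cons s b), e x)) ->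
  (forall c, `|c| <= 1 -> D (f (rv_cons s c.2), e (h c))) ->
  (forall c, `|c| <= 1 -> D (f (rv_cons s c.2), e (h' c))) ->
  (forall c t, `|c| = 1 -> s <= t <= s' ->
    D (f (rv_cons s c.2), e (g0 (c.1, rv_cons t c.2)))) ->
  (forall c, `|c| = 1 -> h c = g0 (c.1, rv_cons s c.2)) ->
  (forall c, `|c| = 1 -> h' c = g0 (c.1, rv_cons s' c.2)) ->
  exists K : 'rV[R]_p * 'rV[R]_m.+1 -> X,
    [/\ {within [set c : 'rV[R]_p * 'rV[R]_m.+1 |
          `|c| <= 1 /\ s <= c.2 ord0 ord0 <= s'], continuous K},
        forall c, `|c| <= 1 -> K (c.1, rv_cons s c.2) = h c,
        forall c, `|c| <= 1 -> K (c.1, rv_cons s' c.2) = h' c,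
        forall c t, `|c| = 1 -> s <= t <= s' ->
          K (c.1, rv_cons t c.2) = g0 (c.1, rv_cons t c.2) &
        forall c t, `|c| <= 1 -> s <= t <= s' ->
          E (f (rv_cons s c.2), e (K (c.1, rv_cons t c.2)))].
Proof.
move=> DE s1 ss' s'1 cf ch ch' cg0 near_s Dh Dh' Dg0 hg0 h'g0.
pose tau (u : R) := s + (u + 1) / 2 * (s' - s).
pose sig (t : R) := (t - s) / (s' - s) * 2 - 1.
have d0 : s' - s != 0 by rewrite subr_eq0 gt_eqF.
have sigK t : tau (sig t) = t.
  by rewrite /tau /sig subrK; field.
have tauN1 : tau (-1) = s by rewrite /tau; ring.
have tau1 : tau 1 = s' by rewrite /tau; field.
have tau_in u : `|u| <= 1 -> s <= tau u <= s'.
  rewrite ler_norml => /andP[u1 u2]; apply/andP; split; rewrite /tau; nra.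
pose rest (d : 'rV[R]_p.+1 * 'rV[R]_m) := (rv_tail d.1, d.2).
pose G0 (d : 'rV[R]_p.+1 * 'rV[R]_m) := let u := d.1 ord0 ord0 in
  if u == -1 then h (rest d) else if u == 1 then h' (rest d)
  else g0 (rv_tail d.1, rv_cons (tau u) d.2).
have crest : continuous rest.
  apply: continuous_pair; last exact: snd_continuous.
  by move=> d; apply: continuous_comp;
    [exact: fst_continuous|exact: rv_tail_continuous].
have chead q : continuous (fun d : 'rV[R]_q.+1 * 'rV[R]_m => d.1 ord0 ord0).
  move=> d.
  apply: (@continuous_comp _ _ _ fst (fun v : 'rV[R]_q.+1 => v ord0 ord0)).
    exact: fst_continuous.
  exact: coord_continuous.
have cnorm (V : normedModType R) : continuous (fun v : V => `|v|).
  by move=> v; exact: norm_continuous.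
have normd (d : 'rV[R]_p.+1 * 'rV[R]_m) :
  `|d| = Num.max `|d.1 ord0 ord0| `|rest d|.
  by case: d => d b; rewrite -norm_consl rv_tailK.
have side_G0 (d : 'rV[R]_p.+1 * 'rV[R]_m) :
  `|d.1 ord0 ord0| <= 1 -> `|rest d| = 1 ->
    G0 d = g0 (rv_tail d.1, rv_cons (tau (d.1 ord0 ord0)) d.2).
  move=> d1 rd1; rewrite /G0; case: eqP => [->|_];
    first by rewrite hg0 // tauN1.
  by case: eqP => [->|//]; rewrite h'g0 // tau1.
have [||||G [cG GG0 EG]] := DE (fun b => f (rv_cons s b)) G0.
- move=> b; apply: (@continuous_comp _ _ _ (fun b => rv_cons s b) f);
    last exact: cf.
  by apply: continuous_rv_cons => x; [apply: cst_continuous|apply: cvg_id].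
- exact: near_s.
- pose A1 := [set d : 'rV[R]_p.+1 * 'rV[R]_m |
    d.1 ord0 ord0 = -1 /\ `|rest d| <= 1].
  pose A2 := [set d : 'rV[R]_p.+1 * 'rV[R]_m |
    d.1 ord0 ord0 = 1 /\ `|rest d| <= 1].
  pose A3 := [set d : 'rV[R]_p.+1 * 'rV[R]_m |
    `|d.1 ord0 ord0| <= 1 /\ `|rest d| = 1].
  have clnorm (r : R) :
      closed [set d : 'rV[R]_p.+1 * 'rV[R]_m | d.1 ord0 ord0 = r].
    apply: (@closed_comp _ _
      (fun d : 'rV[R]_p.+1 * 'rV[R]_m => d.1 ord0 ord0) [set r]).
      by move=> d _; exact: chead.
    exact: closed_eq.
  have clrest (B : set R) : closed B ->
      closed [set d : 'rV[R]_p.+1 * 'rV[R]_m | B `|rest d|].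
    move=> clB; apply: (@closed_comp _ _ (fun d => `|rest d|) B) => // d _.
    by apply: continuous_comp; [exact: crest|exact: cnorm].
  have clA1 : closed A1 by apply: closedI;
    [exact: clnorm|apply: (clrest [set x | x <= 1]); exact: closed_le].
  have clA2 : closed A2 by apply: closedI;
    [exact: clnorm|apply: (clrest [set x | x <= 1]); exact: closed_le].
  have clA3 : closed A3.
    apply: closedI; last by apply: (clrest [set 1]); exact: closed_eq.
    apply: (@closed_comp _ _
      (fun d : 'rV[R]_p.+1 * 'rV[R]_m => `|d.1 ord0 ord0|)
      [set x | x <= 1]); last exact: closed_le.
    move=> d _; apply: continuous_comp; first exact: chead.
    exact: norm_continuous.
  have wrest A B (k : _ -> X) : {within B, continuous k} ->
      (forall d, A d -> B (rest d)) -> {within A, continuous (k \o rest)}.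
    by move=> ck AB; apply: within_comp ck AB; exact: continuous_subspaceT.
  apply: (@continuous_subspaceW _ _ _ (A1 `|` (A2 `|` A3))).
    move=> d /=; rewrite normd => /max_eq1[d1 d2 [d3|d3]]; last by right; right.
    have : `|d.1 ord0 ord0| == 1 by rewrite d3.
    rewrite eqr_norml ler01 andbT => /orP[/eqP d4|/eqP d4].
      by right; left.
    by left.
  apply: withinU_continuous => //; first exact: closedU.
    apply: (@within_eq _ _ _ (h \o rest)) (wrest _ _ _ ch _) =>
      [d [dE _]|d [] //].
    by rewrite /from_subspace /G0 dE eqxx.
  apply: withinU_continuous => //.
    apply: (@within_eq _ _ _ (h' \o rest)) (wrest _ _ _ ch' _) =>
      [d [dE _]|d [] //].
    by rewrite /from_subspace /G0 dE eqxx ifF // -subr_eq0 opprK;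
      apply/negbTE; lra.
  apply: (@within_eq _ _ _ (g0 \o
    (fun d => (rv_tail d.1, rv_cons (tau (d.1 ord0 ord0)) d.2)))).
    by move=> d [d1 d2]; rewrite /from_subspace side_G0.
  apply: within_comp cg0 _.
    apply: continuous_subspaceT; apply: continuous_pair.
      by move=> d; apply: continuous_comp;
        [exact: fst_continuous|exact: rv_tail_continuous].
    apply: continuous_rv_cons; last exact: snd_continuous.
    have ctau : continuous tau.
      rewrite (_ : tau = fun u => ((s' - s) / 2) * u + (s + (s' - s) / 2)).
        exact: affine_continuous.
      by apply/funext => u; rewrite /tau; field.
    by move=> d; apply: continuous_comp; [exact: chead|exact: ctau].
  move=> d [d1 d2]; rewrite /= norm_consr -/(rest d) d2 max_r //.
  have := tau_in _ d1; rewrite ler_norml; lra.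
- move=> d; rewrite normd => /max_eq1[d1 d2 d12].
  have [d3|d3] := eqVneq `|rest d| 1.
    by rewrite side_G0 //; apply: (Dg0 (rest d)) => //; exact: tau_in.
  case: d12 d3 => [d12|->]; last by rewrite eqxx.
  rewrite /G0 => _; have : `|d.1 ord0 ord0| == 1 by rewrite d12.
  rewrite eqr_norml ler01 andbT => /orP[/eqP ->|/eqP ->].
    rewrite eqxx ifF; first exact: (Dh' (rest d)).
    by rewrite -subr_eq0 opprK; apply/negbTE; lra.
  by rewrite eqxx; exact: (Dh (rest d)).
have d_gt0 : 0 < s' - s by rewrite subr_gt0.
have sig_in t : s <= t <= s' -> `|sig t| <= 1.
  move=> /andP[t1 t2]; rewrite ler_norml /sig.
  have : 0 <= (t - s) / (s' - s) <= 1.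
    by rewrite divr_ge0 ?(ltW d_gt0) ?subr_ge0 //= ler_pdivrMr // mul1r lerD2r.
  by move=> /andP[q0 q1]; apply/andP; split; lra.
have sigs : sig s = -1 by rewrite /sig subrr mul0r mul0r sub0r.
have sigs' : sig s' = 1 by rewrite /sig divff //; ring.
have restE t (c : 'rV[R]_p * 'rV[R]_m) : rest (rv_cons t c.1, c.2) = c.
  by rewrite /rest /= rv_consK; case: c.
pose K (c : 'rV[R]_p * 'rV[R]_m.+1) :=
  G (rv_cons (sig (c.2 ord0 ord0)) c.1, rv_tail c.2).
have KE t (c : 'rV[R]_p * 'rV[R]_m) :
    K (c.1, rv_cons t c.2) = G (rv_cons (sig t) c.1, c.2).
  by rewrite /K /= rv_cons_head rv_consK.
have norm_sig t (c : 'rV[R]_p * 'rV[R]_m) :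
  `|(rv_cons t c.1, c.2)| = Num.max `|t| `|c|.
  by rewrite norm_consl; case: c.
exists K; split.
- apply: within_comp cG _ => [|[a b] /= [c1 ct]]; last first.
    move: c1; rewrite -{1}[b]rv_tailK norm_consr norm_consl !ge_max =>
      /andP[_ ->].
    by rewrite sig_in.
  have ch2 : continuous (fun c : 'rV[R]_p * 'rV[R]_m.+1 => c.2 ord0 ord0).
    move=> c.
    apply: (@continuous_comp _ _ _ snd (fun v : 'rV[R]_m.+1 => v ord0 ord0)).
      exact: snd_continuous.
    exact: coord_continuous.
  apply: continuous_subspaceT; apply: continuous_pair; last first.
    by move=> d; apply: continuous_comp;
      [exact: snd_continuous|exact: rv_tail_continuous].
  apply: continuous_rv_cons; last exact: fst_continuous.
  have csig : continuous sig.
    rewrite (_ : sig = fun u =>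
      (2 / (s' - s)) * u + (- (s / (s' - s) * 2) - 1)).
      exact: affine_continuous.
    by apply/funext => u; rewrite /sig; field.
  by move=> d; apply: continuous_comp; [exact: ch2|exact: csig].
- move=> c c1; rewrite KE sigs GG0 /G0 /= ?rv_cons_head ?eqxx ?restE //.
  by rewrite norm_sig normrN normr1 max_l.
- move=> c c1; rewrite KE sigs' GG0 /G0 /= ?rv_cons_head ?restE; last first.
    by rewrite norm_sig normr1 max_l.
  by rewrite eqxx ifF // -subr_eq0 opprK; apply/negbTE; lra.
- move=> c t c1 ts; rewrite KE GG0; last by rewrite norm_sig c1 max_r // sig_in.
  rewrite side_G0 /= ?rv_cons_head ?restE ?rv_consK ?sigK //; exact: sig_in.
- move=> c t c1 ts; rewrite KE.
  by apply: (EG (rv_cons (sig t) c.1, c.2)); rewrite norm_sig ge_max c1 sig_in.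
Qed.

Definition approximable p m := forall E : set (Y * Y), entourage E ->
  exists2 D : set (Y * Y), entourage D & relative_approximation p m D E.

Lemma norm_rv0 (v : 'rV[R]_0) : `|v| = 0.
Proof. by rewrite (thinmx0 v) normr0. Qed.

Lemma continuous_modulus m (f : 'rV[R]_m -> Y) (E : set (Y * Y)) :
  continuous f -> entourage E -> exists2 d : R, 0 < d &
    forall v w, `|v| <= 1 -> `|v - w| < d -> E (f v, f w).
Proof.
move=> cf entE; have [D entD HD] := uniform_continuity_near_compact
  (@rv_ball_compact R m) (fun v _ => cf v) entE.
move: entD; rewrite -entourage_ballE => -[d /= d0 dD]; exists d => // v w v1 vw.
by apply: HD => //; apply: dD; rewrite /= -ball_normE.
Qed.

(** When the second factor is a point, [f] is a constant and the claim is the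
filling of cells; in dimension zero the boundary is empty, and the filling is
any point of [X] near the value of [f]. *)
Lemma approximable0 n p :
  (forall E, entourage E -> exists2 D : set (Y * Y), entourage D &
    forall k, (k <= n)%N -> fills_cells (R := R) e k D E) ->
  (p <= n.+1)%N -> approximable p 0.
Proof.
move=> fill pn E entE; case: p pn => [_|k kn].
  exists E => // f g0 _ near_f _ _.
  have [x fx] := near_f 0 (eq_ind_r (fun r => r <= 1) ler01 (norm_rv0 0)).
  have c0 (c : 'rV[R]_0 * 'rV[R]_0) : `|c| = 0.
    by rewrite prod_normE !norm_rv0 maxxx.
  exists (fun=> x); split.
  - by apply: continuous_subspaceT => c; exact: cst_continuous.
  - by move=> c; rewrite c0 => /eqP; rewrite eq_sym oner_eq0.
  - by move=> c _; rewrite (thinmx0 c.2).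
have [D entD HD] := fill E entE; exists D => // f g0 _ _ cg0 Dg0.
have normc (a : 'rV[R]_k.+1) b : `|(a, b : 'rV[R]_0)| = `|a|.
  by rewrite prod_normE /= norm_rv0 max_l.
have [||H [cH Hg EH]] := HD k kn (f 0) (fun a => g0 (a, 0)).
- apply: within_comp cg0 _ => [|a /= a1]; last by rewrite normc.
  apply: continuous_subspaceT; apply: continuous_pair => a; first exact: cvg_id.
  exact: cst_continuous.
- by move=> a a1; apply: (Dg0 (a, 0)); rewrite normc.
exists (fun c => H c.1); split.
- apply: within_comp cH _ => [|[a b] /=]; last by rewrite normc.
  exact/continuous_subspaceT/fst_continuous.
- by move=> [a b]; rewrite normc /= => a1; rewrite Hg // (thinmx0 b).
- by move=> [a b]; rewrite normc /= => a1; rewrite (thinmx0 b); exact: EH.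
Qed.

Section Step.
Variables p m : nat.
Hypothesis approx_interface : approximable p m.
Hypothesis approx_slab : approximable p.+1 m.

(** The approximations on the interfaces between slabs.  The two outer faces lie
in the boundary, so there they must be the given [g0]. *)
Lemma interface_family (D0 : set (Y * Y)) : entourage D0 ->
  exists D, entourage D /\ D `<=` D0 /\
  forall (f : 'rV[R]_m.+1 -> Y) (g0 : 'rV[R]_p * 'rV[R]_m.+1 -> X),
  continuous f ->
  (forall b, `|b| <= 1 -> exists x, D (f b, e x)) ->
  {within [set c | `|c| = 1], continuous g0} ->
  (forall c, `|c| = 1 -> D (f c.2, e (g0 c))) ->
  exists h : R -> 'rV[R]_p * 'rV[R]_m -> X, forall s, `|s| <= 1 ->
    [/\ {within [set c | `|c| <= 1], continuous (h s)},
        forall c, `|c| = 1 -> h s c = g0 (c.1, rv_cons s c.2),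
        forall c, `|c| <= 1 -> D0 (f (rv_cons s c.2), e (h s c)) &
        `|s| = 1 -> forall c, `|c| <= 1 -> h s c = g0 (c.1, rv_cons s c.2)].
Proof.
move=> entD0; have [D1 entD1 HD1] := approx_interface entD0.
exists (D1 `&` D0); split; first exact: filterI.
split=> [? []//|f g0 cf near_f cg0 Dg0].
have ccons s : continuous (fun c : 'rV[R]_p * 'rV[R]_m => (c.1, rv_cons s c.2)).
  apply: continuous_pair; first exact: fst_continuous.
  apply: continuous_rv_cons; last exact: snd_continuous.
  by move=> x; exact: cst_continuous.
have norm_cons s (c : 'rV[R]_p * 'rV[R]_m) :
    `|(c.1, rv_cons s c.2)| = Num.max `|s| `|c|.
  by case: c => a b; rewrite norm_consr.
pose admissible s h := [/\ {within [set c | `|c| <= 1], continuous h},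
    forall c, `|c| = 1 -> h c = g0 (c.1, rv_cons s c.2),
    forall c, `|c| <= 1 -> D0 (f (rv_cons s c.2), e (h c)) &
    `|s| = 1 -> forall c, `|c| <= 1 -> h c = g0 (c.1, rv_cons s c.2)].
have [|h hP] := @choice _ _ (fun s h => `|s| <= 1 -> admissible s h);
  last first.
  by exists h.
move=> s.
have [s1|s1] := leP `|s| 1; last by exists (fun c => g0 (c.1, rv_cons s c.2)).
have [s_eq1|s_neq1] := eqVneq `|s| 1.
  have side (c : 'rV[R]_p * 'rV[R]_m) :
    `|c| <= 1 -> `|(c.1, rv_cons s c.2)| = 1.
    by move=> c1; rewrite norm_cons s_eq1 max_l.
  exists (fun c => g0 (c.1, rv_cons s c.2)) => _; split=> //.
    by apply: within_comp cg0 side; exact/continuous_subspaceT/ccons.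
  by move=> c c1; have [] := Dg0 _ (side c c1).
have [||||h [ch hg0 D0h]] := HD1 (fun b => f (rv_cons s b))
    (fun c => g0 (c.1, rv_cons s c.2)).
- move=> b; apply: (@continuous_comp _ _ _ (fun b => rv_cons s b) f);
    last exact: cf.
  by apply: continuous_rv_cons => x; [apply: cst_continuous|apply: cvg_id].
- move=> b b1; have [|x [? _]] := near_f (rv_cons s b); last by exists x.
  by rewrite rv_norm_cons ge_max s1.
- apply: within_comp cg0 _; first exact/continuous_subspaceT/ccons.
  by move=> c c1; rewrite /= norm_cons c1 max_r.
- move=> c c1; have [|//] := Dg0 (c.1, rv_cons s c.2).
  by rewrite norm_cons c1 max_r.
exists h => _; split=> // s_eq1; by rewrite s_eq1 eqxx in s_neq1.
Qed.

(** Cut the second factor along its first coordinate into slabs on which [f]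
nearly does not depend on that coordinate.  Approximate first on the interfaces,
which have dimension [p + m], then extend over the slabs one after the other.
The values on an interface do not come from the previous slab, so errors do not
accumulate along the way. *)
Lemma approximable_step : approximable p m.+1.
Proof.
move=> E entE; pose E1 := split_ent E.
have entE1 : entourage E1 by exact: entourage_split_ent.
have [D2 entD2 HD2] := approx_slab entE1.
pose S2 := split_ent D2;
  have entS2 : entourage S2 by exact: entourage_split_ent.
have [D [entD [DSE HD]]] := interface_family (filterI entS2 entE).
have S2D2 : S2 `<=` D2 by exact: split_ent_subset.
exists D => // f g0 cf near_f cg0 Dg0.
have [h Hh] := HD f g0 cf near_f cg0 Dg0.
have [d d0 Hd] := continuous_modulus cf (filterI entS2 entE1).
pose hd (c : 'rV[R]_p * 'rV[R]_m.+1) : R := c.2 ord0 ord0.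
pose rest (c : 'rV[R]_p * 'rV[R]_m.+1) := (c.1, rv_tail c.2).
have hdrest c : (c.1, rv_cons (hd c) (rest c).2) = c.
  by rewrite /= rv_tailK; case: c.
have normc c : `|c| = Num.max `|hd c| `|rest c|.
  by case: c => a b; rewrite -norm_consr rv_tailK.
have hd1 c : `|c| <= 1 -> `|hd c| <= 1 by rewrite normc ge_max => /andP[].
have rest1 c : `|c| <= 1 -> `|rest c| <= 1 by rewrite normc ge_max => /andP[].
have norm_cons s (c : 'rV[R]_p * 'rV[R]_m) :
    `|(c.1, rv_cons s c.2)| = Num.max `|s| `|c|.
  by case: c => a b; rewrite norm_consr.
have f_close u u' (c : 'rV[R]_p * 'rV[R]_m) : `|u| <= 1 -> `|c| <= 1 ->
    `|u - u'| < d -> (S2 `&` E1) (f (rv_cons u c.2), f (rv_cons u' c.2)).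
  move=> u1 c1 uu'; apply: Hd.
    rewrite rv_norm_cons ge_max u1 (le_trans _ c1) //.
    by rewrite prod_normE le_max lexx orbT.
  have -> : rv_cons u c.2 - rv_cons u' c.2 = rv_cons (u - u') 0.
    by apply/rowP => i; rewrite !mxE; case: unliftP => [j|] _;
      rewrite ?mxE ?subrr.
  by rewrite rv_norm_cons normr0 max_l.
(* The slabs are filled in increasing order.  The values at level [t] belong to
   the invariant so that the next slab fits. *)
pose good t := exists g : 'rV[R]_p * 'rV[R]_m.+1 -> X,
  [/\ {within [set c | `|c| <= 1 /\ hd c <= t], continuous g},
      forall c, `|c| = 1 -> hd c <= t -> g c = g0 c,
      forall c, `|c| <= 1 -> hd c <= t -> E (f c.2, e (g c)) &
      forall c, `|c| <= 1 -> g (c.1, rv_cons t c.2) = h t c].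
have goodN1 : good (-1).
  have side c : `|c| <= 1 -> hd c <= -1 -> `|c| = 1.
    move=> c1 cN1; apply/eqP; rewrite eq_le c1 normc le_max.
    by rewrite lerNr in cN1; rewrite (le_trans cN1) // -normrN ler_norm.
  exists g0; split=> //.
  - by apply: continuous_subspaceW cg0 => c [c1 cN1]; exact: side.
  - by move=> c c1 cN1; have [] := DSE _ (Dg0 _ (side c c1 cN1)).
  - move=> c c1; have [|_ _ _ ->//] := Hh (-1); rewrite normrN normr1 //.
have step t t' : -1 <= t -> t < t' -> t' <= 1 -> t' - t < d -> good t ->
  good t'.
  move=> t1 tt' t'1 ttd [g [cg gg0 Eg gh]].
  have t_1 : `|t| <= 1 by rewrite ler_norml; lra.
  have t'_1 : `|t'| <= 1 by rewrite ler_norml; lra.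
  have [cht hg0 Dht _] := Hh t t_1; have [cht' h'g0 Dht' _] := Hh t' t'_1.
  have in_slab u : t <= u <= t' -> `|u| <= 1 /\ `|t - u| < d.
    by move=> /andP[u1 u2]; rewrite ler_norml ltr_norml; split; lra.
  have [||||K [cK Kt Kt' Kg0 EK]] := slab_fill (s := t) (s' := t')
      HD2 t1 tt' t'1 cf cht cht' cg0 _ _ _ _ hg0 h'g0.
  - move=> b b1; have [|x Dx] := near_f (rv_cons t b); last first.
      by exists x; apply: S2D2; have [] := DSE _ Dx.
    by rewrite rv_norm_cons ge_max t_1.
  - by move=> c c1; apply: S2D2; have [] := Dht c c1.
  - move=> c c1; apply: (entourage_split (f (rv_cons t' c.2))) => //.
      have [|_ /f_close H] := in_slab t'; first lra.
      by have [] := H _ t_1 c1.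
    by have [] := Dht' c c1.
  - move=> c u c1 /in_slab[u1 tu];
      apply: (entourage_split (f (rv_cons u c.2))) => //.
      have c1' : `|c| <= 1 by rewrite c1.
      by have [] := f_close t u c t_1 c1' tu.
    have [|] := DSE _ (Dg0 (c.1, rv_cons u c.2) _) => //.
    by rewrite norm_cons c1 max_r.
  pose g' c := if hd c <= t then g c else K c.
  have g'E c : `|c| <= 1 -> t <= hd c -> g' c = K c.
    rewrite /g' => c1 tc; case: ifP => // ct.
    have tE : hd c = t by apply/eqP; rewrite eq_le ct.
    have := gh _ (rest1 _ c1); rewrite -(Kt _ (rest1 _ c1)) -tE.
    by rewrite hdrest.
  have head_continuous : continuous hd.
    move=> c.
    apply: (@continuous_comp _ _ _ snd (fun v : 'rV[R]_m.+1 => v ord0 ord0)).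
      exact: snd_continuous.
    exact: coord_continuous.
  have closed_head (B : set R) : closed B ->
      closed [set c : 'rV[R]_p * 'rV[R]_m.+1 | `|c| <= 1 /\ B (hd c)].
    move=> clB; apply: closedI.
      apply: (@closed_comp _ _ (fun c : 'rV[R]_p * 'rV[R]_m.+1 => `|c|)
        [set x | x <= 1]); last exact: closed_le.
      by move=> c _; exact: norm_continuous.
    by apply: (@closed_comp _ _ hd B) => // c _; exact: head_continuous.
  exists g'; split.
  - apply: (@continuous_subspaceW _ _ _ ([set c | `|c| <= 1 /\ hd c <= t] `|`
      [set c | `|c| <= 1 /\ t <= hd c <= t'])).
      move=> c [c1 ct']; have [ct|/ltW tc] := leP (hd c) t; first by left.
      by right; split; rewrite ?tc.
    apply: withinU_continuous.
    + by apply: (closed_head [set x | x <= t]); exact: closed_le.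
    + apply: (closed_head [set x | t <= x <= t']).
      rewrite (_ : [set _ | _] = `[t, t']%classic);
        first exact: interval_closed.
      by apply/seteqP; split=> x; rewrite /= in_itv.
    + apply: within_eq cg => c [_ ct]; by rewrite /from_subspace /g' ct.
    + by apply: within_eq cK => c [c1 /andP[tc _]]; rewrite /from_subspace g'E.
  - move=> c c1 ct'; have [ct|t_c] := leP (hd c) t.
      by rewrite /g' ct gg0.
    have tc := ltW t_c.
    have c1' : `|c| <= 1 by rewrite c1.
    rewrite g'E //.
    have [c01|c0_1] := eqVneq `|rest c| 1.
      by have := Kg0 (rest c) (hd c) c01; rewrite hdrest tc ct' => ->.
    (* A boundary point above level [t] off the sides lies on the last face. *)
    have hd_eq1 : `|hd c| = 1.
      by move: c1; rewrite normc => /max_eq1[_ _ []] // /eqP;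
        rewrite (negbTE c0_1).
    have hdE : hd c = t'.
      have /eqP := hd_eq1; rewrite eqr_norml ler01 andbT => /orP[] /eqP; lra.
    have t'_eq1 : `|t'| = 1 by rewrite -hdE.
    have [_ _ _ /(_ t'_eq1 _ (rest1 _ c1'))] := Hh t' t'_1.
    by rewrite -(Kt' _ (rest1 _ c1')) -hdE hdrest.
  - move=> c c1 ct'; have [ct|/ltW tc] := leP (hd c) t.
      by rewrite /g' ct; exact: Eg.
    have tct' : t <= hd c <= t' by rewrite tc.
    have [hdc1 thd] := in_slab _ tct'.
    rewrite g'E //; apply: (entourage_split (f (rv_cons t (rest c).2))) => //.
      rewrite distrC in thd.
      have [_] := f_close (hd c) t (rest c) hdc1 (rest1 _ c1) thd.
      by rewrite /= rv_tailK.
    by have := EK (rest c) (hd c) (rest1 _ c1) tct'; rewrite hdrest.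
  - move=> c c1; rewrite g'E ?Kt' //.
      by rewrite norm_cons ge_max t'_1.
    by rewrite /hd /= rv_cons_head ltW.
pose N := Num.bound (2 / d).
have N_gt : 2 / d < N%:R by apply: archi_boundP; rewrite divr_ge0 // ltW.
have N0 : 0 < N%:R :> R by apply: le_lt_trans N_gt; rewrite divr_ge0 // ltW.
have good_all i : (i <= N)%N -> good (-1 + i%:R / N%:R * 2).
  elim: i => [|i IHi] iN; first by rewrite mul0r mul0r addr0.
  have iN' : i.+1%:R / N%:R <= 1 :> R by rewrite ler_pdivrMr // mul1r ler_nat.
  have stepE : i.+1%:R / N%:R = i%:R / N%:R + (N%:R^-1)%R :> R.
    by rewrite -addn1 natrD mulrDl mul1r.
  have Ninv0 : 0 < (N%:R^-1)%R :> R by rewrite invr_gt0.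
  have i0 : 0 <= i%:R / N%:R :> R by rewrite divr_ge0.
  have Nd : (N%:R^-1)%R * 2 < d.
    by rewrite mulrC ltr_pdivrMr // mulrC -ltr_pdivrMr.
  apply: step (IHi (ltnW iN)); lra.
have := good_all N (leqnn _); rewrite divff ?gt_eqF // => -[g [cg gg0 Eg _]].
have le_1 c : `|c| <= 1 -> hd c <= -1 + 1 * 2.
  by move=> /hd1; rewrite ler_norml => /andP[_]; lra.
exists g; split.
- by apply: continuous_subspaceW cg => c c1; split=> //; exact: le_1.
- by move=> c c1; apply: gg0 => //; apply: le_1; rewrite c1.
- by move=> c c1; apply: Eg => //; exact: le_1.
Qed.

End Step.
End RelativeApproximation.

(** * Approximation of maps of spheres *)

Section SphereApproximation.
Local Open Scope relation_scope.
Context {R : realType} {X : topologicalType} {Y : uniformType}.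
Variable e : X -> Y.

(** The total dimension [p + m] never grows in the induction on [m]. *)
Lemma approximable_le n :
  (forall p, (p <= n.+1)%N -> approximable (R := R) e p 0) ->
  forall m p, (p + m <= n.+1)%N -> approximable (R := R) e p m.
Proof.
move=> base; elim=> [|m IHm] p; first by rewrite addn0; exact: base.
move=> pm; apply: approximable_step; apply: IHm; last by rewrite addSn -addnS.
by apply: leq_trans pm; rewrite leq_add2l leqnSn.
Qed.

(** Compactness of the cell makes continuity along its boundary uniform. *)
Lemma boundary_collar m (G : 'rV[R]_m -> X) (x0 : X) (W : set X) :
  {within [set v | `|v| <= 1], continuous G} ->
  (forall v, `|v| = 1 -> G v = x0) -> nbhs x0 W ->
  exists2 d : R, 0 < d & forall v, `|v| <= 1 -> 1 - d < `|v| -> W (G v).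
Proof.
move=> /withinP cG G1 Wx0.
have /compact_near_coveringP/near_covering_withinP cB := @rv_ball_compact R m.
have near_cov : forall v : 'rV[R]_m, [set v | `|v| <= 1] v ->
    \forall v' \near v & d \near (0 : R)^'+,
      [set v | `|v| <= 1] v' -> 1 - d < `|v'| -> W (G v').
  move=> v /= v1; have [v_eq1|v_neq1] := eqVneq `|v| 1.
    have := cG v v1 W; rewrite G1 // => /(_ Wx0) nW.
    exists ([set v' | `|v'| <= 1 -> W (G v')], setT); first by split=> //;
      exact: filterT.
    by move=> [v' d] /= [WG _] v'1 _; exact: WG.
  have v_lt1 : `|v| < 1 by rewrite lt_neqAle v_neq1.
  exists ([set v' | `|v'| < (1 + `|v|) / 2], [set d | d < (1 - `|v|) / 2]).
    split=> /=.
      have : \forall x \near `|v|, x < (1 + `|v|) / 2 by apply: lt_nbhsl; lra.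
      exact: (@norm_continuous _ _ v).
    by apply: nbhs_right_lt; lra.
  by move=> [v' d] /= [v'_lt d_lt] _; lra.
have := cB _ _ (fun d v' => 1 - d < `|v'| -> W (G v')) _ near_cov.
move=> /(_ _)/filterI/(_ (nbhs_right_gt 0))/filter_ex[d [H d0]].
by exists d => // v v1; exact: H.
Qed.

Definition approximates_spheres k (D E : set (Y * Y)) :=
  forall f : 'rV[R]_k.+1 -> Y, {within sphere R k, continuous f} ->
  (forall v, sphere R k v -> exists x, D (f v, e x)) ->
  exists g : 'rV[R]_k.+1 -> X, {within sphere R k, continuous g} /\
    forall v, sphere R k v -> E (f v, e (g v)).

Section Stereographic.
Variable k : nat.
Implicit Types (v : 'rV[R]_k) (z : 'rV[R]_k.+1).

(** [collapse] maps the open cell homeomorphically onto the sphere minus the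
pole [rv_cons 1 0], and the boundary to the pole.  It is the inverse
stereographic projection applied to [v / (1 - `|v|)], written so that it makes
sense for [`|v| = 1]. *)
Definition collapse_den v : R := sqnorm v + (1 - `|v|) ^+ 2.

Definition collapse v : 'rV[R]_k.+1 :=
  rv_cons ((sqnorm v - (1 - `|v|) ^+ 2) / collapse_den v)
          ((2 * (1 - `|v|) / collapse_den v) *: v).

Definition uncollapse z : 'rV[R]_k :=
  (1 - z ord0 ord0 + `|rv_tail z|)^-1 *: rv_tail z.

Lemma collapse_den_gt0 v : 0 < collapse_den v.
Proof.
rewrite /collapse_den; have [->|v0] := eqVneq v 0.
  by rewrite normr0 subr0 expr1n ltr_wpDl // sqnorm_ge0.
by rewrite ltr_pwDl ?sqnorm_gt0 // sqr_ge0.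
Qed.

Lemma collapse_sphere v : sphere R k (collapse v).
Proof.
rewrite /sphere /= -/(sqnorm _) /collapse sqnorm_cons sqnormZ.
have := collapse_den_gt0 v; rewrite /collapse_den.
set s := sqnorm v; set r := `|v| => N0.
by field; rewrite gt_eqF.
Qed.

Lemma collapse_boundary v : `|v| = 1 -> collapse v = rv_cons 1 0.
Proof.
move=> v1; have v0 : v != 0 by rewrite -normr_eq0 v1 oner_neq0.
rewrite /collapse /collapse_den v1 subrr expr0n /= subr0 addr0 divff ?gt_eqF
  ?sqnorm_gt0 //.
by rewrite mulr0 mul0r scale0r.
Qed.

Lemma collapse_continuous : continuous collapse.
Proof.
have c1r : continuous (fun v : 'rV[R]_k => 1 - `|v|).
  apply: continuous_subr; first by move=> v; exact: cst_continuous.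
  by move=> v; exact: norm_continuous.
have c1r2 := continuous_exprn (i := 2) c1r.
have cN : continuous collapse_den.
  by apply: continuous_addr => //; exact: sqnorm_continuous.
have cV : continuous (fun v => (collapse_den v)^-1)%R.
  by move=> v; apply: continuousV;
    [rewrite gt_eqF // collapse_den_gt0|exact: cN].
apply: continuous_rv_cons.
  apply: continuous_mulr => //; apply: continuous_subr => //.
  exact: sqnorm_continuous.
apply/continuous_subspace_setT/continuous_scale; apply: continuous_subspaceT;
  last first.
  by move=> v; exact: cvg_id.
apply: continuous_mulr => //; apply: continuous_mulr => //.
by move=> v; exact: cst_continuous.
Qed.

Lemma sphere_head z : sphere R k z ->
  z ord0 ord0 ^+ 2 + sqnorm (rv_tail z) = 1.
Proof. by rewrite -{1}[z]rv_tailK /sphere /= -/(sqnorm _) sqnorm_cons. Qed.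

Lemma sphere_head_le1 z : sphere R k z -> z ord0 ord0 <= 1.
Proof. by move=> /sphere_head; have := sqnorm_ge0 (rv_tail z); nra. Qed.

Lemma sphere_north z : sphere R k z -> z ord0 ord0 = 1 -> z = rv_cons 1 0.
Proof.
move=> /sphere_head + z1; rewrite z1 expr1n => z0.
have [t0|/sqnorm_gt0 t0] := eqVneq (rv_tail z) 0; last by exfalso; lra.
by rewrite -[z]rv_tailK z1 t0.
Qed.

Lemma uncollapse_den_gt0 z : sphere R k z -> z ord0 ord0 != 1 ->
  0 < 1 - z ord0 ord0 + `|rv_tail z|.
Proof.
move=> zS z1; have : z ord0 ord0 < 1 by rewrite lt_neqAle z1 sphere_head_le1.
by have := normr_ge0 (rv_tail z); lra.
Qed.

Lemma norm_uncollapse z : sphere R k z -> z ord0 ord0 != 1 ->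
  `|uncollapse z| = `|rv_tail z| / (1 - z ord0 ord0 + `|rv_tail z|).
Proof.
move=> zS z1; rewrite normrZ ger0_norm ?invr_ge0 ?ltW ?uncollapse_den_gt0 //.
by rewrite mulrC.
Qed.

Lemma norm_uncollapse_le1 z : sphere R k z -> z ord0 ord0 != 1 ->
  `|uncollapse z| <= 1.
Proof.
move=> zS z1; rewrite norm_uncollapse // ler_pdivrMr ?uncollapse_den_gt0 //.
by rewrite mul1r lerDr subr_ge0 sphere_head_le1.
Qed.

Lemma uncollapseK z : sphere R k z -> z ord0 ord0 != 1 ->
  collapse (uncollapse z) = z.
Proof.
move=> zS z1; have M0 := uncollapse_den_gt0 zS z1.
have b1 : z ord0 ord0 < 1 by rewrite lt_neqAle z1 sphere_head_le1.
have sq : sqnorm (rv_tail z) = 1 - z ord0 ord0 ^+ 2.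
  by rewrite -(sphere_head zS); ring.
rewrite /collapse /collapse_den norm_uncollapse // /uncollapse sqnormZ scalerA
  sq.
rewrite -[RHS]rv_tailK; set M := 1 - _ + _ in M0 *.
have rM : `|rv_tail z| = M - (1 - z ord0 ord0) by rewrite /M; ring.
rewrite rM; set b := z ord0 ord0 in b1 *.
have M_neq0 : M != 0 by rewrite gt_eqF.
have b_neq1 : 1 - b != 0 by rewrite subr_eq0 gt_eqF.
have -> : (M^-1)%R ^+ 2 * (1 - b ^+ 2) + (1 - (M - (1 - b)) / M) ^+ 2 =
    2 * (1 - b) * (M^-1)%R ^+ 2 by field.
congr rv_cons; first by field; rewrite b_neq1 M_neq0.
rewrite [X in X *: _](_ : _ = 1) ?scale1r //.
by field; rewrite b_neq1 M_neq0.
Qed.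

Lemma uncollapse_continuous : {within sphere R k `&` [set z | z ord0 ord0 != 1],
  continuous uncollapse}.
Proof.
apply: continuous_scale; last exact/continuous_subspaceT/rv_tail_continuous.
apply: within_inv => [z [zS z1]|];
  first by rewrite gt_eqF // uncollapse_den_gt0.
apply: continuous_subspaceT; apply: continuous_addr.
  apply: continuous_subr; first by move=> z; exact: cst_continuous.
  exact: coord_continuous.
move=> z; apply: (@continuous_comp _ _ _ (@rv_tail R k) (fun v => `|v|)).
  exact: rv_tail_continuous.
exact: norm_continuous.
Qed.

(** Let [b] be the first coordinate of a point of the sphere.  Since [1 - b ^ 2]
is the squared norm of the tail, near the pole [1 - b] is quadratically small
compared with the tail.  In dimension zero the statement holds because the pole
is isolated. *)
Lemma uncollapse_near_boundary (d : R) : 0 < d ->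
  \forall z \near (rv_cons 1 0 : 'rV[R]_k.+1), sphere R k z ->
    (z : 'rV[R]_k.+1) ord0 ord0 != 1 -> 1 - d < `|uncollapse z|.
Proof.
move=> d0.
have near_tail : \forall z \near (rv_cons 1 0 : 'rV[R]_k.+1),
    k%:R * `|rv_tail z| < d.
  have ct : continuous (fun z : 'rV[R]_k.+1 => k%:R * `|rv_tail z|).
    apply: continuous_mulr; first by move=> z; exact: cst_continuous.
    move=> z; apply: (@continuous_comp _ _ _ (@rv_tail R k) (fun v => `|v|)).
      exact: rv_tail_continuous.
    exact: norm_continuous.
  have : k%:R * `|rv_tail (rv_cons 1 0 : 'rV[R]_k.+1)| < d.
    by rewrite rv_consK normr0 mulr0.
  by move=> /lt_nbhsl; exact: ct.
have near_head : \forall z \near (rv_cons 1 0 : 'rV[R]_k.+1),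
    0 < (z : 'rV[R]_k.+1) ord0 ord0.
  have : 0 < (rv_cons 1 0 : 'rV[R]_k.+1) ord0 ord0 by rewrite rv_cons_head.
  by move=> /lt_nbhsr; exact: coord_continuous.
apply: filterS2 near_tail near_head => z tail_lt head_gt zS z1.
rewrite norm_uncollapse // ltr_pdivlMr ?uncollapse_den_gt0 //.
have := sphere_head zS; have := sqnorm_le (rv_tail z).
have b1 : z ord0 ord0 < 1 by rewrite lt_neqAle z1 sphere_head_le1.
set s := sqnorm _; set r := `|rv_tail z| in tail_lt *;
  set b := z ord0 ord0 in b1 head_gt *.
have r0 : 0 <= r by exact: normr_ge0.
move=> sr bs.
have h1 : 1 - b <= s by nra.
have h2 : s <= d * r by apply: le_trans sr _;
  rewrite expr2 mulrA ler_wpM2r // ltW.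
have h3 : 0 < d * (1 - b) by rewrite mulr_gt0 // subr_gt0.
nra.
Qed.

End Stereographic.

(** Composed with [collapse], a map of the sphere becomes a map of a cell that
is constant on the boundary.  An approximation of the latter with a constant
value on the boundary descends to the sphere, the pole taking that value. *)
Lemma sphere_approximation k : approximable (R := R) e 0 k ->
  forall E, entourage E -> exists2 D : set (Y * Y), entourage D &
  approximates_spheres k D E.
Proof.
move=> approx E entE; have [D entD HD] := approx E entE.
exists (D `&` E) => [|f cf near_f]; first exact: filterI.
have north : sphere R k (rv_cons 1 0).
  rewrite /sphere /= -/(sqnorm _) sqnorm_cons expr1n.
  rewrite /sqnorm big1 ?addr0 // => i _.
  by rewrite mxE expr0n.
have [x0 [Dx0 Ex0]] := near_f _ north.
have norm_snd (c : 'rV[R]_0 * 'rV[R]_k) : `|c| = `|c.2|.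
  by rewrite prod_normE norm_rv0 max_r.
have [||||G [cG G1 EG]] := HD (f \o @collapse k) (fun=> x0).
- apply/continuous_subspace_setT; apply: within_comp cf _ => [|v _].
    exact/continuous_subspaceT/collapse_continuous.
  exact: collapse_sphere.
- move=> v _; have [x [Dx _]] := near_f _ (collapse_sphere v).
  by exists x.
- by apply: continuous_subspaceT => c; exact: cst_continuous.
- by move=> c; rewrite norm_snd => c1; rewrite /= collapse_boundary.
pose G' v := G (0, v).
have cG' : {within [set v | `|v| <= 1], continuous G'}.
  apply: within_comp cG _ => [|v /=]; last by rewrite norm_snd.
  apply: continuous_subspaceT; apply: continuous_pair => v; last exact: cvg_id.
  exact: cst_continuous.
have G'1 v : `|v| = 1 -> G' v = x0 by move=> v1; apply: G1; rewrite norm_snd.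
pose g (z : 'rV[R]_k.+1) := if z ord0 ord0 == 1 then x0 else G' (uncollapse z).
exists g; rewrite /g; split; last first.
  move=> z zS; case: eqVneq => [/(sphere_north zS) ->//|z1].
  have := EG (0, uncollapse z); rewrite norm_snd /= uncollapseK //.
  by apply; exact: norm_uncollapse_le1.
apply/withinP => z zS; case: (eqVneq (z ord0 ord0) 1) => [z1|z1].
  move=> W Wx0; have [d d0 Hd] := boundary_collar cG' G'1 Wx0.
  rewrite (sphere_north zS z1); apply: filterS (uncollapse_near_boundary k d0).
  move=> w Hw wS; case: eqVneq => [_|w1]; first exact: nbhs_singleton.
  by apply: Hd; [exact: norm_uncollapse_le1|exact: Hw].
move=> W nW; apply: (within_openI (f := g)
    (O := [set z : 'rV[R]_k.+1 | z ord0 ord0 != 1])) => //;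
      last by rewrite /g (negbTE z1).
  apply: (@open_comp _ _ (fun z : 'rV[R]_k.+1 => z ord0 ord0) [set x | x != 1]).
    by move=> v _; exact: coord_continuous.
  exact: open_neq.
apply: (@within_eq _ _ _ (G' \o @uncollapse k)).
  by move=> w [_ /= w1]; rewrite /from_subspace /g (negbTE w1).
apply: within_comp (@uncollapse_continuous k) cG' _ => w [wS w1].
exact: norm_uncollapse_le1.
Qed.

End SphereApproximation.

(** * Approximate local connectedness *)

Section Concatenation.
Context {R : realType} {X : topologicalType} {I : choiceType}.
Local Notation cube := (@tychonoff_cube R I).
Variable e : X -> cube.

(** First move [f] to [g] along segments, then contract [g] inside [X]. *)
Lemma null_homotopic_close k (U : set cube) (W : set X)
    (f : 'rV[R]_k.+1 -> cube) (g : 'rV[R]_k.+1 -> X) :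
  continuous e -> {within sphere R k, continuous f} ->
  {within sphere R k, continuous g} ->
  (forall v t, sphere R k v -> 0 <= t <= 1 -> U (mix t (f v) (e (g v)))) ->
  (forall x, W x -> U (e x)) -> null_homotopic_in W g -> null_homotopic_in U f.
Proof.
move=> ce cf cg mixU WU [H1 [c [cH1 H1W H10 H11]]].
pose H (p : R * 'rV[R]_k.+1) := if p.1 <= 1 / 2
  then mix (2 * p.1) (f p.2) (e (g p.2)) else e (H1 (2 * p.1 - 1, p.2)).
have HE t v : sphere R k v -> 1 / 2 <= t -> H (t, v) = e (H1 (2 * t - 1, v)).
  move=> vS t1; rewrite /H /=; case: ifP => // t2.
  have -> : t = 1 / 2 by lra.
  have -> : 2 * (1 / 2) = 1 :> R by field.
  by rewrite mix1 subrr H10.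
exists H, (e c); split.
- pose A1 : set (R * 'rV[R]_k.+1) := `[0, 1 / 2]%classic `*` sphere R k.
  pose A2 : set (R * 'rV[R]_k.+1) := `[1 / 2, 1]%classic `*` sphere R k.
  apply: (@continuous_subspaceW _ _ _ (A1 `|` A2)).
    move=> [t v] [/=]; rewrite in_itv /= => /andP[t0 t1] vS.
    have [t2|/ltW t2] := leP t (1 / 2).
      by left; split=> //=; rewrite in_itv /= t0.
    by right; split=> //=; rewrite in_itv /= t2.
  have cfst (A : set (R * 'rV[R]_k.+1)) : {within A, continuous fst}.
    exact/continuous_subspaceT/fst_continuous.
  have csnd (A : set (R * 'rV[R]_k.+1)) : {within A, continuous snd}.
    exact/continuous_subspaceT/snd_continuous.
  apply: withinU_continuous.
  + by apply: closed_setX; [exact: interval_closed|exact: sphere_closed].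
  + by apply: closed_setX; [exact: interval_closed|exact: sphere_closed].
  + apply: (@within_eq _ _ _ ((fun c => mix c.1 c.2.1 c.2.2) \o
      (fun p => (2 * p.1, (f p.2, e (g p.2)))))).
      move=> [t v] [/=]; rewrite in_itv /= => /andP[t0 t1] _.
      by rewrite /from_subspace /H /= t1.
    apply: (within_comp (B := setT)) => //;
      last exact/continuous_subspaceT/mix_continuous.
    apply: within_pair.
      apply: continuous_subspaceT; apply: continuous_mulr;
        last exact: fst_continuous.
      by move=> ?; exact: cst_continuous.
    apply: within_pair.
      by apply: within_comp (csnd _) cf _ => -[t v] [].
    apply: (within_comp (B := setT) (f := g \o snd)) => //.
      by apply: within_comp (csnd _) cg _ => -[t v] [].
    exact: continuous_subspaceT.
  + apply: (@within_eq _ _ _ (e \o (H1 \o (fun p => (2 * p.1 - 1, p.2))))).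
      move=> [t v] [/=]; rewrite in_itv /= => /andP[t0 t1] vS.
      by rewrite /from_subspace HE.
    apply: (within_comp (B := setT)) => //; last exact: continuous_subspaceT.
    apply: within_comp cH1 _.
      apply: within_pair => //; apply: continuous_subspaceT.
      apply: continuous_subr; last by move=> ?; exact: cst_continuous.
      apply: continuous_mulr; last exact: fst_continuous.
      by move=> ?; exact: cst_continuous.
    move=> [t v] [/=]; rewrite in_itv /= => /andP[t0 t1] vS.
    by split=> //=; rewrite in_itv /=; apply/andP; split; lra.
- move=> _ [[t v] [/= + vS] <-]; rewrite in_itv /= => /andP[t0 t1].
  have [t2|/ltW t2] := leP t (1 / 2).
    rewrite /H /= t2; apply: mixU => //; lra.
  rewrite HE //; apply: WU; apply: H1W; exists (2 * t - 1, v) => //.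
  by split=> //=; rewrite in_itv /=; apply/andP; split; lra.
- move=> v vS; rewrite /H /= mulr0 mix0 ifT //; lra.
- move=> v vS; rewrite HE //; last lra.
  by rewrite (_ : 2 * 1 - 1 = 1) ?H11 //; ring.
Qed.

End Concatenation.

Section Main.
Local Open Scope relation_scope.
Context {R : realType} {X : topologicalType} {I : choiceType}.
Local Notation cube := (@tychonoff_cube R I).
Variable e : X -> cube.

Lemma approximation_below n : LC R n X -> is_embedding e -> compact (range e) ->
  forall E : set (cube * cube), entourage E ->
  exists2 D : set (cube * cube), entourage D &
  forall k, (k <= n)%N -> approximates_spheres (R := R) e k D E.
Proof.
move=> hLC emb_e cM E entE.
have approx : forall m p, (p + m <= n.+1)%N -> approximable (R := R) e p m.
  apply: approximable_le => p pn.
  exact: approximable0 (uniform_fill emb_e cM hLC) pn.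
apply: (@entourage_bounded _ n
  (fun k D => approximates_spheres (R := R) e k D E)).
  move=> k D D' D'D HD f cf near_f; apply: HD => // v /near_f[x Dx].
  by exists x; exact: D'D.
by move=> k kn; apply: sphere_approximation => //; apply: approx; exact: leqW.
Qed.

(** Let the spheres in [V1] contract in [U].  The neighbourhood [V] is a ball
about [x] whose margin leaves room for approximations: points of [X] close to
[V] lie in [V1], and the closure of [V] is a compact subset of [U], hence of
every open extension [Ut] of [U].  The scale at which [Vt] hugs [V] is then
chosen according to [Ut]. *)
Lemma LC_ALC_in n : LC R n X -> is_compactum X -> is_embedding e ->
  ALC_in R n (range e).
Proof.
move=> hLC [cX hX] emb_e; have [injE contE _] := emb_e.
have [cY hY] := @cube_compactum R I.
have cM : compact (range e).
  by apply: continuous_compact => //; exact: continuous_subspaceT.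
have clM : closed (range e) by exact: compact_closed.
split=> // _ U [x _ <-] UM /open_subspaceP[O oO OU] Ux.
have inO y : range e y -> O y <-> U y.
  move=> My; split=> [Oy|Uy].
    by have : (U `&` range e) y by [rewrite -OU]; case.
  by have : (O `&` range e) y by [rewrite OU]; case.
pose W := e @^-1` U.
have oW : open W.
  rewrite (_ : W = e @^-1` O); last first.
    by apply/seteqP; split=> z /=; apply: (inO _ _).1 || apply: (inO _ _).2;
      exists z.
  by apply: open_comp => // z _; exact: contE.
have [V1 [nV1 V1W]] := hLC x W oW Ux.
have [E0 entE0 E0sub] : exists2 E0 : set (cube * cube), entourage E0 &
    forall y, E0 (e x, y) -> O y /\ forall x', e x' = y -> V1 x'.
  have Ox : O (e x) by apply/inO => //; exists x.
  have : nbhs (e x) (O `&` [set y | forall x', e x' = y -> V1 x']).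
    by apply: filterI; [exact: open_nbhs_nbhs|exact: embedding_nbhs].
  move=> /nbhsP[E0 entE0 E0sub]; exists E0 => // y E0y.
  by apply: E0sub; apply/xsectionP.
pose E1 := split_ent E0;
  have entE1 : entourage E1 by exact: entourage_split_ent.
pose O' : set cube := interior (xsection E1 (e x)).
pose V := range e `&` O'.
have O'E1 y : O' y -> E1 (e x, y) by move=> /interior_subset /xsectionP.
exists V; split.
- by move=> y [].
- have Mx : range e (e x) by exists x.
  rewrite /nbhs /= -(nbhs_subspace_in Mx) /within /=.
  have : nbhs (e x) O' by apply: nbhs_interior; exact: nbhs_entourage.
  by apply: filterS => y O'y My.
move=> Ut [oUt UtU]; pose C := range e `&` closure (xsection E1 (e x)).
have cC : compact C by apply: compact_closedI => //; exact: closed_closure.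
have CUt y : C y -> Ut y.
  move=> [My /(ent_closure entE0)/xsectionP/E0sub[/(inO _ My) Uy _]].
  by have : (Ut `&` range e) y by [rewrite UtU]; case.
have [|D0 entD0 HD0] := lebesgue_entourage (V := fun _ : unit => Ut) cC.
  by move=> y /CUt Uty; exists tt; apply: open_nbhs_nbhs.
pose S0 := split_ent D0;
  have entS0 : entourage S0 by exact: entourage_split_ent.
pose S1 := split_ent E1;
  have entS1 : entourage S1 by exact: entourage_split_ent.
have [Dm entDm HDm] := mix_close entS0.
have [D entD HD] := approximation_below hLC emb_e cM (filterI entDm entS1).
(* [S0] keeps the segments from [f] to [g] in [Ut], [S1] keeps the values of [g]
   in [V1], and the inverse of [D] provides [g]. *)
pose D' := S0 `&` (S1 `&` D^-1).
have entD' : entourage D' by do 2?[apply: filterI => //]; exact: entourage_inv.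
pose N : set cube := \bigcup_(y in V) interior (xsection D' y).
pose Vt := O' `&` N.
exists Vt; split.
  split; first by apply: openI; [|apply: bigcup_open => ? _];
    exact: open_interior.
  apply/seteqP; split=> [y [[O'y _] My] //|y [My O'y]]; split=> //; split=> //.
  by exists y; [split|exact: nbhs_entourage].
move=> k kn f [cf fVt].
have near_V v : sphere R k v -> exists2 x', V (e x') & D' (e x', f v).
  move=> vS; have [_ [_ [[x' _ <-] O'x'] /interior_subset /xsectionP D'x']] :
    Vt (f v).
    by apply: fVt; exists v.
  by exists x' => //; split=> //; exists x'.
have [|g [cg fg]] := HD k kn f cf.
  by move=> v /near_V[x' _ [_ [_ Dx']]]; exists x'.
apply: (null_homotopic_close contE cf cg (W := W)) => //.
- move=> v t vS t01; have [x' [Mx' O'x'] [S0x' _]] := near_V v vS.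
  have [Dmg _] := fg v vS.
  have Cx' : C (e x').
    by split=> //; apply: subset_closure; exact: interior_subset.
  have [_ UtD] := HD0 _ Cx'; apply: UtD.
  by apply: (entourage_split (f v)) => //; exact: HDm.
- by move=> z Wz; have : (Ut `&` range e) (e z) by [rewrite UtU]; case.
- apply: V1W => //; split=> // _ [v vS <-].
  have [x' [_ O'x'] [_ [S1x' _]]] := near_V v vS; have [_ S1g] := fg v vS.
  have E0g : E0 (e x, e (g v)).
    apply: (entourage_split (e x')) => //; first exact: O'E1.
    exact: (entourage_split (f v)).
  by have [_] := E0sub _ E0g; apply.
Qed.

End Main.

Theorem corollary3p2 (R : realType) (n : nat) (X : topologicalType)
  (hX : is_compactum X) (hLC : LC R n X) : ALC_compactum R n X.
Proof.
split=> //; exists (tychonoff_cube (@unit_functions R X)), (@evaluation R X);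
  split.
- exact: cube_compact_ANR.
- exact: evaluation_embedding.
- exact: LC_ALC_in hLC hX (evaluation_embedding hX).
Qed.
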